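(* The braided Thompson group $bV$ is not uniformly perfect.
   Context: A group $\Gamma$ is uniformly perfect if there exists $N\in\mathbf{N}$ such that every element of $\Gamma$ can be written as a product of at most $N$ commutators. Trees and braids. A tree means a finite, rooted, planar, binary tree (possibly the trivial one-vertex tree); its leaves are numbered $1,\dots,n$ from left to right. A caret is a vertex together with two children. $B_n$ is the braid group on $n$ strands. Braids are drawn vertically, and the product $\beta\gamma$ is obtained by placing $\beta$ above $\gamma$. $\rho_n\colon B_n\to S_n$ is the standard projection: $\rho_n(\beta)(k)$ is the top position of the strand of $\beta$ starting at position $k$ at the bottom. The group $bV$. A representative triple is $(T_-,\beta,T_+)$ with $T_\pm$ trees having the same number $n$ of leaves and $\beta\in B_n$. For $1\le k\le n$ its $k$th expansion is $(T_-',\beta',T_+')$, where $T_+'$ is $T_+$ with a caret added at its $k$th leaf, $T_-'$ is $T_-$ with a caret added at its $\rho_n(\beta)(k)$th leaf, and $\beta'\in B_{n+1}$ is obtained from $\beta$ by bifurcating the $k$th strand (counting at the bottom) into two parallel strands. Let $[T_-,\beta,T_+]$ denote the class under the equivalence relation generated by expansion. The elements of $bV$ are these classes; any two elements can, after expansions, be written as $[T_-,\beta,T_+]$ and $[T_+,\gamma,U_+]$, and their product is $[T_-,\beta\gamma,U_+]$. *)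

(* Defs.v *)
From HB Require Import structures.
From mathcomp Require Import all_boot all_fingroup.
From mathcomp Require Import boolp.
From mathcomp Require Import zify.
From Stdlib Require Eqdep_dec PeanoNat.

Set Implicit Arguments.
Unset Strict Implicit.
Unset Printing Implicit Defensive.

Local Open Scope quotient_scope.
Local Open Scope group_scope.

Definition uniformly_perfect (G : groupType) : Prop :=
  exists N : nat, forall g : G, exists2 s : seq (G * G),
    (size s <= N)%N & g = \prod_(c <- s) [~ c.1, c.2].

(* The letter (i, b) is the Artin generator sigma_i if b is true and its
   inverse otherwise; strands and generators are numbered from 0, so sigma_i
   crosses the strands in positions i and i+1. *)
Definition braid_word (n : nat) : Type := seq ('I_n.-1 * bool).

Inductive braid_word_eq (n : nat) : braid_word n -> braid_word n -> Prop :=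
| bw_refl u : braid_word_eq u u
| bw_sym u v : braid_word_eq u v -> braid_word_eq v u
| bw_trans v u w : braid_word_eq u v -> braid_word_eq v w -> braid_word_eq u w
| bw_cat u u' v v' : braid_word_eq u u' -> braid_word_eq v v' ->
    braid_word_eq (u ++ v) (u' ++ v')
| bw_cancel i b : braid_word_eq [:: (i, b); (i, ~~ b)] [::]
| bw_far (i j : 'I_n.-1) : (i.+1 < j)%N ->
    braid_word_eq [:: (i, true); (j, true)] [:: (j, true); (i, true)]
| bw_braid (i j : 'I_n.-1) : (i.+1 = j :> nat)%N ->
    braid_word_eq [:: (i, true); (j, true); (i, true)]
                  [:: (j, true); (i, true); (j, true)].

Definition braid_word_eqb n : rel (braid_word n) :=
  fun u v => `[< braid_word_eq u v >].

Lemma braid_word_eqb_equiv n : equiv_class_of (@braid_word_eqb n).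
Proof.
split=> [u | u v | v u w].
- exact/asboolP/bw_refl.
- by apply/asboolP/asboolP; apply: bw_sym.
- by move=> /asboolP uv /asboolP vw; apply/asboolP; apply: bw_trans vw.
Qed.

Canonical braid_word_equiv n :=
  EquivRelPack (@braid_word_eqb_equiv n).

Definition braid (n : nat) : Type := {eq_quot braid_word_equiv n}.

HB.instance Definition _ n := Choice.on (braid n).
HB.instance Definition _ n := EqQuotient.on (braid n).

Definition braid_of n (u : braid_word n) : braid n := \pi_(braid n) u.

Definition word_of n : braid n -> braid_word n := generic_quotient.repr.

Lemma word_ofK n : cancel (@word_of n) (@braid_of n).
Proof. exact: reprK. Qed.

Lemma braid_ofP n (u v : braid_word n) :
  braid_of u = braid_of v <-> braid_word_eq u v.
Proof.
split=> [/eqP|uv]; first by rewrite eqmodE => /asboolP.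
by apply/eqP; rewrite eqmodE; apply/asboolP.
Qed.

Lemma braidW n (P : braid n -> Prop) : (forall u, P (braid_of u)) -> forall b, P b.
Proof. by move=> Pu b; rewrite -[b]word_ofK; apply: Pu. Qed.

Lemma word_of_braid_of n (u : braid_word n) : braid_word_eq (word_of (braid_of u)) u.
Proof. by apply/braid_ofP; rewrite word_ofK. Qed.

Definition word_inv n (u : braid_word n) : braid_word n :=
  rev [seq (l.1, ~~ l.2) | l <- u].

(* The product of braids is concatenation: the first letter of a word is the
   topmost crossing. *)
Definition braid_mul n (a b : braid n) : braid n := braid_of (word_of a ++ word_of b).
Definition braid_one n : braid n := braid_of [::].
Definition braid_inv n (a : braid n) : braid n := braid_of (word_inv (word_of a)).

Lemma braid_mulE n (u v : braid_word n) :
  braid_mul (braid_of u) (braid_of v) = braid_of (u ++ v).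
Proof. by apply/braid_ofP/bw_cat; apply: word_of_braid_of. Qed.

Lemma braid_mulA n : associative (@braid_mul n).
Proof.
by elim/braidW=> u; elim/braidW=> v; elim/braidW=> w; rewrite !braid_mulE catA.
Qed.

Lemma braid_mul1g n : left_id (braid_one n) (@braid_mul n).
Proof. by elim/braidW=> u; rewrite braid_mulE. Qed.

Lemma braid_mulg1 n : right_id (braid_one n) (@braid_mul n).
Proof. by elim/braidW=> u; rewrite braid_mulE cats0. Qed.

Lemma word_mulV n (u : braid_word n) : braid_word_eq (u ++ word_inv u) [::].
Proof.
elim: u => [|[i b] u IH]; first exact: bw_refl.
rewrite /word_inv /= rev_cons -cats1 catA -cat1s.
apply: (bw_trans (v := [:: (i, b)] ++ [::] ++ [:: (i, ~~ b)])).
  apply: bw_cat; first exact: bw_refl.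
  by apply: bw_cat; last exact: bw_refl.
exact: bw_cancel.
Qed.

Lemma word_invK n : involutive (@word_inv n).
Proof.
move=> u; rewrite /word_inv map_rev revK -map_comp -[RHS]map_id.
by apply: eq_map => -[i b] /=; rewrite negbK.
Qed.

Lemma braid_mulgV n : right_inverse (braid_one n) (@braid_inv n) (@braid_mul n).
Proof.
move=> b; rewrite /braid_inv -{1}[b]word_ofK braid_mulE.
exact/braid_ofP/word_mulV.
Qed.

Lemma braid_mulVg n : left_inverse (braid_one n) (@braid_inv n) (@braid_mul n).
Proof.
move=> b; rewrite /braid_inv -{2}[b]word_ofK braid_mulE.
by apply/braid_ofP; have := word_mulV (word_inv (word_of b)); rewrite word_invK.
Qed.

HB.instance Definition _ n := isGroup.Build (braid n)
  (@braid_mulA n) (@braid_mul1g n) (@braid_mulg1 n) (@braid_mulVg n) (@braid_mulgV n).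

Lemma braid_ofM n (u v : braid_word n) : braid_of (u ++ v) = braid_of u * braid_of v.
Proof. by rewrite -braid_mulE. Qed.

Lemma braid_of_nil n : braid_of [::] = 1 :> braid n.
Proof. by []. Qed.

Lemma succ_ord_subproof n (i : 'I_n.-1) : (i.+1 < n)%N.
Proof. by case: i => i /=; lia. Qed.

Definition low_ord n (i : 'I_n.-1) : 'I_n := Ordinal (ltnW (succ_ord_subproof i)).
Definition high_ord n (i : 'I_n.-1) : 'I_n := Ordinal (succ_ord_subproof i).

Definition letter_perm n (l : 'I_n.-1 * bool) : 'S_n :=
  tperm (low_ord l.1) (high_ord l.1).

(* Permutations compose from left to right in the library, whereas a strand
   followed from the bottom meets the letters of a word from right to left. *)
Definition word_perm n (u : braid_word n) : 'S_n :=
  \prod_(l <- rev u) letter_perm l.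

Lemma word_perm_nil n : word_perm [::] = 1 :> 'S_n.
Proof. by rewrite /word_perm big_nil. Qed.

Lemma word_perm_cons n l (u : braid_word n) : word_perm (l :: u) = word_perm u * letter_perm l.
Proof. by rewrite /word_perm rev_cons -cats1 big_cat big_seq1. Qed.

Lemma word_perm_cat n (u v : braid_word n) :
  word_perm (u ++ v) = word_perm v * word_perm u.
Proof. by rewrite /word_perm rev_cat big_cat. Qed.

Definition swapn (i k : nat) : nat :=
  if k == i then i.+1 else if k == i.+1 then i else k.

Ltac case_if :=
  match goal with
  | |- context [if ?c then _ else _] =>
    lazymatch c with
    | context [if _ then _ else _] => fail
    | _ => case: (boolP c) => ? /=
    end
  end.

Ltac case_lia := repeat case_if; try lia.

Lemma letter_permE n (l : 'I_n.-1 * bool) (k : 'I_n) :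
  letter_perm l k = swapn l.1 k :> nat.
Proof.
rewrite /letter_perm /swapn.
case: tpermP => [->|->|ki kj] /=; [by rewrite eqxx | by rewrite eqn_leq ltnn /= eqxx|].
case: (eqVneq (k : nat) l.1) => [e|_]; first by case: ki; apply: val_inj.
case: (eqVneq (k : nat) l.1.+1) => [e|//].
by case: kj; apply: val_inj.
Qed.

Lemma word_perm_eq n (u v : braid_word n) : braid_word_eq u v -> word_perm u = word_perm v.
Proof.
elim=> {u v} [// | u v _ -> // | v u w _ -> _ -> // | u u' v v' _ Hu _ Hv | i b | i j ij | i j ij].
- by rewrite !word_perm_cat Hu Hv.
- by rewrite !word_perm_cons word_perm_nil mul1g /letter_perm tperm2.
- apply/permP=> k; apply: val_inj.
  rewrite !word_perm_cons word_perm_nil mul1g !permM perm1 /= !letter_permE /= /swapn.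
  case_lia.
- apply/permP=> k; apply: val_inj.
  rewrite !word_perm_cons word_perm_nil mul1g !permM perm1 /= !letter_permE /= /swapn.
  case_lia.
Qed.

(* rho b k is the position at the top of the strand which is at position k at
   the bottom. *)
Definition rho n (b : braid n) : 'S_n := word_perm (word_of b).

Lemma rhoE n (u : braid_word n) : rho (braid_of u) = word_perm u.
Proof. exact/word_perm_eq/word_of_braid_of. Qed.

Lemma rhoM n (a b : braid n) k : rho (a * b) k = rho a (rho b k).
Proof.
elim/braidW: a => u; elim/braidW: b => v.
by rewrite -braid_ofM !rhoE word_perm_cat permM.
Qed.

Lemma rho1 n k : rho (1 : braid n) k = k.
Proof. by rewrite -braid_of_nil rhoE word_perm_nil perm1. Qed.

(* Bifurcation of the strand in position k below the crossing of strands i and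
   i+1.  If this strand does not take part in the crossing, only the index of
   the crossing may shift: lift k i is i+1 if k <= i, and i otherwise.
   Otherwise the two copies of the strand cross the other one in succession;
   from top to bottom the crossings are i, i+1 if k = i, and i+1, i if
   k = i+1. *)
Definition bifurcate_letter n (l : 'I_n.-1 * bool) (k : 'I_n) : braid_word n.+1 :=
  if (k == low_ord l.1) || (k == high_ord l.1)
  then [:: (k, l.2); (lift k l.1, l.2)] else [:: (lift k l.1, l.2)].

Fixpoint bifurcate_word n (u : braid_word n) (k : 'I_n) : braid_word n.+1 :=
  if u is l :: v then bifurcate_letter l (word_perm v k) ++ bifurcate_word v k
  else [::].

Lemma bifurcate_word_cat n (u v : braid_word n) k :
  bifurcate_word (u ++ v) k =
    bifurcate_word u (word_perm v k) ++ bifurcate_word v k.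
Proof.
by elim: u => //= l u ->; rewrite word_perm_cat permM catA.
Qed.

(* Versions with indices in nat: generators, bifurcations of one crossing, and
   double bifurcations of one crossing. *)
Definition gsig n (i : nat) (b : bool) : braid n :=
  if insub i is Some i' then braid_of [:: (i', b)] else 1.

Lemma sigE n (i : 'I_n.-1) b : braid_of [:: (i, b)] = gsig n i b.
Proof. by rewrite /gsig valK. Qed.

Lemma sigK n i b : gsig n i b * gsig n i (~~ b) = 1.
Proof.
rewrite /gsig; case: insubP => [i' _ _|_]; last by rewrite mulg1.
by rewrite -braid_ofM; apply/braid_ofP/bw_cancel.
Qed.

Lemma sig_far n i j : (i.+1 < j)%N -> gsig n i true * gsig n j true = gsig n j true * gsig n i true.
Proof.
rewrite /gsig => ij; case: insubP => [i' _ Hi|_]; last by rewrite mulg1 mul1g.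
case: insubP => [j' _ Hj|_]; last by rewrite mulg1 mul1g.
by rewrite -!braid_ofM; apply/braid_ofP/bw_far; rewrite Hi Hj.
Qed.

Lemma sig_braid n i : (i.+1 < n.-1)%N ->
  gsig n i true * gsig n i.+1 true * gsig n i true =
  gsig n i.+1 true * gsig n i true * gsig n i.+1 true.
Proof.
rewrite /gsig => ij; case: insubP => [i' _ Hi|]; last lia.
case: insubP => [j' _ Hj|]; last lia.
rewrite -!braid_ofM; apply/braid_ofP/bw_braid; by rewrite Hi Hj.
Qed.

Definition bfl n (i k : nat) b : braid n :=
  if (k == i) || (k == i.+1) then gsig n k b * gsig n (bump k i) b else gsig n (bump k i) b.

Lemma bfl_lt n i k b : (k < i)%N -> bfl n i k b = gsig n i.+1 b.
Proof. by move=> ki; rewrite /bfl /bump (ltnW ki); case: ifP => //; lia. Qed.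

Lemma bfl_gt n i k b : (i.+1 < k)%N -> bfl n i k b = gsig n i b.
Proof. by move=> ki; rewrite /bfl /bump leqNgt (ltnW ki); case: ifP => //; lia. Qed.

Lemma bfl_l n i b : bfl n i i b = gsig n i b * gsig n i.+1 b.
Proof. by rewrite /bfl /bump leqnn eqxx. Qed.

Lemma bfl_r n i b : bfl n i i.+1 b = gsig n i.+1 b * gsig n i b.
Proof. by rewrite /bfl /bump eqxx orbT ltnn. Qed.

Lemma swapn_lt i k : (k < i)%N -> swapn i k = k.
Proof. rewrite /swapn => ki; case_lia. Qed.

Lemma swapn_gt i k : (i.+1 < k)%N -> swapn i k = k.
Proof. rewrite /swapn => ki; case_lia. Qed.

Lemma swapn_l i : swapn i i = i.+1.
Proof. rewrite /swapn; case_lia. Qed.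

Lemma swapn_r i : swapn i i.+1 = i.
Proof. rewrite /swapn; case_lia. Qed.

Ltac bfl_simp :=
  repeat first
    [ progress rewrite ?(swapn_l, swapn_r, bfl_l, bfl_r)
    | match goal with
      | |- context [swapn ?i ?k] =>
        first [ rewrite (@swapn_lt i k ltac:(lia))
              | rewrite (@swapn_gt i k ltac:(lia)) ]
      | |- context [bfl ?n ?i ?k ?b] =>
        first [ rewrite (@bfl_lt n i k b ltac:(lia))
              | rewrite (@bfl_gt n i k b ltac:(lia)) ]
      end ].

Lemma bifurcate_letterE n (l : 'I_n.-1 * bool) (k : 'I_n) :
  braid_of (bifurcate_letter l k) = bfl n.+1 l.1 k l.2.
Proof.
rewrite /bifurcate_letter /bfl -!val_eqE /=.
case: ifP => _; last by rewrite sigE.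
by rewrite -cat1s braid_ofM !sigE.
Qed.

Lemma bfl_cancel n i k b : bfl n i (swapn i k) b * bfl n i k (~~ b) = 1.
Proof.
have [->|ki] := eqVneq k i; first by bfl_simp; rewrite mulgA -[X in X * _]mulgA sigK mulg1 sigK.
have [->|kSi] := eqVneq k i.+1.
  by bfl_simp; rewrite mulgA -[X in X * _]mulgA sigK mulg1 sigK.
by have [ltki|leik] := ltnP k i; bfl_simp; rewrite sigK.
Qed.

Lemma bfl_far n i j k : (i.+1 < j)%N ->
  bfl n i (swapn j k) true * bfl n j k true =
  bfl n j (swapn i k) true * bfl n i k true.
Proof.
move=> ij.
have [->|ki] := eqVneq k i.
  bfl_simp; rewrite -mulgA [gsig n i.+1 _ * _]sig_far; last lia.
  by rewrite !mulgA [gsig n i _ * _]sig_far; last lia.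
have [->|kSi] := eqVneq k i.+1.
  bfl_simp; rewrite -mulgA [gsig n i _ * _]sig_far; last lia.
  by rewrite !mulgA [gsig n i.+1 _ * _]sig_far; last lia.
have [->|kj] := eqVneq k j.
  bfl_simp; rewrite mulgA [gsig n i _ * _]sig_far; last lia.
  by rewrite -!mulgA [gsig n i _ * _]sig_far; last lia.
have [->|kSj] := eqVneq k j.+1.
  bfl_simp; rewrite mulgA [gsig n i _ * _]sig_far; last lia.
  by rewrite -!mulgA [gsig n i _ * _]sig_far; last lia.
have [ltki|] := ltnP k i; first by bfl_simp; rewrite sig_far; last lia.
move=> leik; have [ltjk|] := ltnP j.+1 k; first by bfl_simp; rewrite sig_far; last lia.
by move=> lekj; bfl_simp; rewrite sig_far; last lia.
Qed.

Lemma bfl_braid n i k : (i.+2 < n.-1)%N ->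
  bfl n i (swapn i.+1 (swapn i k)) true *
    (bfl n i.+1 (swapn i k) true * bfl n i k true) =
  bfl n i.+1 (swapn i (swapn i.+1 k)) true *
    (bfl n i (swapn i.+1 k) true * bfl n i.+1 k true).
Proof.
move=> ni; have hab := @sig_braid n i (ltnW ni); have hbc := @sig_braid n i.+1 ni.
have [ltki|] := ltnP k i; first by bfl_simp; rewrite !mulgA hbc.
have [lt2k|] := ltnP i.+2 k; first by move=> _; bfl_simp; rewrite !mulgA hab.
have hac := @sig_far n i i.+2 (ltnSn _).
set a := gsig n i true in hab hbc hac *; set b := gsig n i.+1 true in hab hbc hac *.
set c := gsig n i.+2 true in hab hbc hac *.
have e1 x : a * (b * (a * x)) = b * (a * (b * x)) by rewrite !mulgA hab.
have e2 x : b * (c * (b * x)) = c * (b * (c * x)) by rewrite !mulgA hbc.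
have e3 x : a * (c * x) = c * (a * x) by rewrite !mulgA hac.
move=> ki ik; have [->|->|->] : [\/ k = i, k = i.+1 | k = i.+2].
  have [?|ki'] := eqVneq k i; first exact: Or31.
  by have [?|?] := eqVneq k i.+1; [exact: Or32 | apply: Or33; lia].
all: bfl_simp; rewrite -[LHS]mulg1 -[RHS]mulg1 -!mulgA -/a -/b -/c.
- by rewrite -e3 e1 e2 e3.
- by rewrite e2 e3 -[c * (a * 1)]e3 e1.
- by rewrite e3 e1 e2 -[c * (a * _)]e3.
Qed.

Lemma bifurcate_word_eq n (u v : braid_word n) : braid_word_eq u v ->
  forall k, braid_word_eq (bifurcate_word u k) (bifurcate_word v k).
Proof.
elim=> {u v} [u k|u v _ IH k|v u w _ uv _ vw k|u u' v v' ee IHu ev IHv k|i b k|i j ij k|i j ij k].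
- exact: bw_refl.
- exact: bw_sym.
- exact: bw_trans (vw k).
- by rewrite !bifurcate_word_cat (word_perm_eq ev); apply: bw_cat.
- apply/braid_ofP; rewrite /= ?cats0 !word_perm_cons !word_perm_nil !mul1g !perm1.
  by rewrite braid_ofM !bifurcate_letterE /= letter_permE bfl_cancel.
- apply/braid_ofP; rewrite /= ?cats0 !word_perm_cons !word_perm_nil !mul1g !perm1.
  by rewrite !braid_ofM !bifurcate_letterE /= !letter_permE /= bfl_far.
- apply/braid_ofP; rewrite /= ?cats0 !word_perm_cons !word_perm_nil !mul1g !permM !perm1.
  rewrite !braid_ofM !bifurcate_letterE /= !letter_permE /= -!ij.
  by apply: bfl_braid; have := ltn_ord j; rewrite -ij; lia.
Qed.

Definition bifurcate n (b : braid n) (k : 'I_n) : braid n.+1 :=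
  braid_of (bifurcate_word (word_of b) k).

Lemma bifurcateE n (u : braid_word n) k :
  bifurcate (braid_of u) k = braid_of (bifurcate_word u k).
Proof. exact/braid_ofP/bifurcate_word_eq/word_of_braid_of. Qed.

Lemma bifurcateM n (a b : braid n) k :
  bifurcate (a * b) k = bifurcate a (rho b k) * bifurcate b k.
Proof.
elim/braidW: a => u; elim/braidW: b => v.
by rewrite -braid_ofM !bifurcateE rhoE bifurcate_word_cat braid_ofM.
Qed.

Lemma bifurcate1 n k : bifurcate (1 : braid n) k = 1.
Proof. by rewrite -braid_of_nil bifurcateE. Qed.

Lemma rhoK n (b : braid n) k : rho b^-1 (rho b k) = k.
Proof. by rewrite -rhoM mulVg rho1. Qed.

Lemma bifurcateV n (b : braid n) k :
  (bifurcate b k)^-1 = bifurcate b^-1 (rho b k).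
Proof.
apply: (mulIg (bifurcate b k)).
by rewrite mulVg -bifurcateM mulVg bifurcate1.
Qed.

(* Position of strand (or leaf) l after strand (or leaf) k has been doubled. *)
Definition shift n (k l : 'I_n) : 'I_n.+1 := lift (widen_ord (leqnSn n) k) l.

Definition bpn (i k : nat) (s : nat) : nat :=
  if k == i then swapn i (swapn i.+1 s) else
  if k == i.+1 then swapn i.+1 (swapn i s) else swapn (bump k i) s.

Lemma word_perm_bifurcate_letter n (l : 'I_n.-1 * bool) (k : 'I_n) (s : 'I_n.+1) :
  word_perm (bifurcate_letter l k) s = bpn l.1 k s :> nat.
Proof.
rewrite /bifurcate_letter /bpn -!val_eqE /=.
have [e|ki] /= := eqVneq (k : nat) l.1; last have [e|kSi] /= := eqVneq (k : nat) l.1.+1.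
all: rewrite !word_perm_cons word_perm_nil !mul1g ?permM !letter_permE /= /bump ?e ?ltnn ?leqnn //.
Qed.

Lemma bpn_shift i k l : k != l ->
  bpn i k (bump k l) = bump (swapn i k) (swapn i l).
Proof. rewrite /bpn /swapn /bump => kl; case_lia. Qed.

Lemma rho_bifurcate_shift n (b : braid n) (k l : 'I_n) : k != l ->
  rho (bifurcate b k) (shift k l) = shift (rho b k) (rho b l).
Proof.
move=> kl; elim/braidW: b => u; rewrite bifurcateE !rhoE.
elim: u => [|x u IH] /=; first by rewrite !word_perm_nil !perm1.
rewrite word_perm_cat word_perm_cons !permM IH; apply: val_inj => /=.
rewrite word_perm_bifurcate_letter /= bpn_shift ?letter_permE //.
by rewrite val_eqE (inj_eq perm_inj).
Qed.

Lemma sig_farb n i j b : (i.+1 < j)%N -> gsig n i b * gsig n j b = gsig n j b * gsig n i b.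
Proof.
move=> ij; case: b; first exact: sig_far.
have sV m : gsig n m false = (gsig n m true)^-1.
  by apply: (mulgI (gsig n m true)); rewrite mulgV (sigK n m true).
by rewrite !sV -!invgM (sig_far _ ij).
Qed.

Definition bbfl n (i k l : nat) b : braid n :=
  if (k == i) || (k == i.+1)
  then bfl n k (swapn (bump k i) l) b * bfl n (bump k i) l b
  else bfl n (bump k i) l b.

Lemma bbfl_lt n i k l b : (k < i)%N -> bbfl n i k l b = bfl n i.+1 l b.
Proof. by move=> ki; rewrite /bbfl /bump (ltnW ki); case: ifP => //; lia. Qed.

Lemma bbfl_gt n i k l b : (i.+1 < k)%N -> bbfl n i k l b = bfl n i l b.
Proof. by move=> ki; rewrite /bbfl /bump leqNgt (ltnW ki); case: ifP => //; lia. Qed.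

Lemma bbfl_l n i l b :
  bbfl n i i l b = bfl n i (swapn i.+1 l) b * bfl n i.+1 l b.
Proof. by rewrite /bbfl /bump leqnn eqxx. Qed.

Lemma bbfl_r n i l b :
  bbfl n i i.+1 l b = bfl n i.+1 (swapn i l) b * bfl n i l b.
Proof. by rewrite /bbfl /bump eqxx orbT ltnn. Qed.

Ltac bbfl_simp :=
  rewrite ?(bbfl_l, bbfl_r);
  repeat match goal with
  | |- context [bbfl ?n ?i ?k ?l ?b] =>
    first [ rewrite (@bbfl_lt n i k l b ltac:(lia))
          | rewrite (@bbfl_gt n i k l b ltac:(lia)) ]
  end; bfl_simp.

Lemma bbfl_sym n i k l b : (k < l)%N ->
  bbfl n i k (bump k l) b = bbfl n i l (bump l k) b.
Proof.
move=> kl.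
have -> : bump k l = l.+1 by rewrite /bump; lia.
have -> : bump l k = k by rewrite /bump; lia.
have [Ek|ki] := eqVneq k i; last have [Ek|kSi] := eqVneq k i.+1; last have [ltki|leik] := ltnP k i.
all: have [El|li] := eqVneq l i; last have [El|lSi] := eqVneq l i.+1; last have [ltli|leil] := ltnP l i.
all: try lia; subst; try (by bbfl_simp).
bbfl_simp; rewrite -!mulgA; congr (_ * _); rewrite !mulgA; congr (_ * _).
by apply: sig_farb; lia.
Qed.

Lemma bifurcate_bifurcate_letterE n (x : 'I_n.-1 * bool) (k : 'I_n) (l : 'I_n.+1) :
  braid_of (bifurcate_word (bifurcate_letter x k) l) = bbfl n.+2 x.1 k l x.2.
Proof.
rewrite /bifurcate_letter /bbfl -!val_eqE /=; case: ifP => _ /=.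
  rewrite cats0 braid_ofM !bifurcate_letterE word_perm_cons word_perm_nil mul1g.
  by rewrite letter_permE perm1.
by rewrite cats0 bifurcate_letterE word_perm_nil perm1.
Qed.

Lemma bifurcate_bifurcate_letter n (x : 'I_n.-1 * bool) (k l : 'I_n) : k != l ->
  braid_of (bifurcate_word (bifurcate_letter x k) (shift k l)) =
  braid_of (bifurcate_word (bifurcate_letter x l) (shift l k)).
Proof.
rewrite !bifurcate_bifurcate_letterE /= -val_eqE neq_ltn /= => /orP[kl|lk].
  exact: bbfl_sym.
exact/esym/bbfl_sym.
Qed.

Lemma bifurcate_bifurcate n (b : braid n) (k l : 'I_n) : k != l ->
  bifurcate (bifurcate b k) (shift k l) = bifurcate (bifurcate b l) (shift l k).
Proof.
move=> kl; elim/braidW: b => u; rewrite !bifurcateE.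
elim: u => [//|x u IH] /=; rewrite !bifurcate_word_cat !braid_ofM IH.
congr (_ * _); rewrite -!rhoE -!bifurcateE !rho_bifurcate_shift //; last by rewrite eq_sym.
rewrite !bifurcateE; apply: bifurcate_bifurcate_letter.
by rewrite (inj_eq perm_inj).
Qed.

Inductive btree : Type := Leaf | Node (l r : btree).

Fixpoint leaves (t : btree) : nat :=
  if t is Node l r then (leaves l + leaves r)%N else 1%N.

(* A caret is added at leaf k, where leaves are numbered from 0 from left to
   right; the value is irrelevant if k is not smaller than leaves t. *)
Fixpoint add_caret (t : btree) (k : nat) : btree :=
  match t with
  | Leaf => Node Leaf Leaf
  | Node l r => if (k < leaves l)%N then Node (add_caret l k) r
                else Node l (add_caret r (k - leaves l))
  end.

Lemma leaves_gt0 t : (0 < leaves t)%N.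
Proof. by elim: t => //= l Hl r _; rewrite addn_gt0 Hl. Qed.

Lemma leaves_add_caret t k : leaves (add_caret t k) = (leaves t).+1.
Proof.
elim: t k => //= l IHl r IHr k; case: ifP => _ /=.
  by rewrite IHl addSn.
by rewrite IHr addnS.
Qed.

Lemma add_caretC t k l : (k < leaves t)%N -> (l < leaves t)%N -> k != l ->
  add_caret (add_caret t k) (bump k l) = add_caret (add_caret t l) (bump l k).
Proof.
wlog kl : k l / (k < l)%N => [H|].
  move=> kt lt; rewrite neq_ltn => /orP[kl|lk]; first by apply: H; rewrite ?neq_ltn ?kl.
  by apply/esym/H; rewrite ?neq_ltn ?lk.
move=> kt lt _; have -> : bump k l = l.+1 by rewrite /bump; lia.
have -> : bump l k = k by rewrite /bump; lia.
elim: t k l kl kt lt => [|a IHa b IHb] k l kl /=; first by case: k kl; case: l.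
move=> kt lt; have [la|al] := ltnP l (leaves a).
  rewrite (ltn_trans kl la) /= !leaves_add_caret ltnS la (ltnS k) (ltnW (ltn_trans kl la)).
  by rewrite (IHa k l) // (ltn_trans kl la).
have [ka|ak] /= := ltnP k (leaves a).
  by rewrite leaves_add_caret ltnS ltnNge al /= ka subSS.
rewrite !ltnNge (leqW al) ?ak ?al /= subSn // (IHb (k - leaves a) (l - leaves a))%N //; lia.
Qed.

Fixpoint btree_le (t u : btree) : bool :=
  match t, u with
  | Leaf, _ => true
  | Node a b, Node c d => btree_le a c && btree_le b d
  | Node _ _, Leaf => false
  end.

Lemma btree_le_refl t : btree_le t t.
Proof. by elim: t => //= a -> b ->. Qed.

Lemma btree_le_trans t u v : btree_le t u -> btree_le u v -> btree_le t v.
Proof.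
elim: t u v => [//|a IHa b IHb] [//|c d] [//|e f] /= /andP[ac bd] /andP[ce df].
by rewrite (IHa c) // (IHb d).
Qed.

Lemma btree_le_add t k : btree_le t (add_caret t k).
Proof.
elim: t k => //= a IHa b IHb k; case: ifP => _ /=; first by rewrite IHa btree_le_refl.
by rewrite IHb btree_le_refl.
Qed.

Lemma btree_le_leaves t u : btree_le t u -> (leaves t <= leaves u)%N.
Proof.
elim: t u => [u _|a IHa b IHb [//|c d] /= /andP[/IHa ac /IHb bd]]; first exact: leaves_gt0.
exact: leq_add.
Qed.

Lemma btree_le_step t u : btree_le t u ->
  t = u \/ exists2 k, (k < leaves t)%N & btree_le (add_caret t k) u.
Proof.
elim: t u => [[|c d]|a IHa b IHb [//|c d]] /=; [by left | by right; exists 0%N|].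
move=> /andP[ac bd]; case: (IHa _ ac) => [->|[k ka kc]].
  case: (IHb _ bd) => [->|[k kb kd]]; [by left | right].
  exists (leaves c + k)%N; first by rewrite ltn_add2l.
  by rewrite ltnNge leq_addr /= addKn kd btree_le_refl.
right; exists k; first exact: ltn_addr.
by rewrite ka /= kc bd.
Qed.

Lemma btree_le_join t u k l : (k < leaves t)%N -> (l < leaves t)%N -> k != l ->
  btree_le (add_caret t k) u -> btree_le (add_caret t l) u ->
  btree_le (add_caret (add_caret t k) (bump k l)) u.
Proof.
wlog kl : k l / (k < l)%N => [H|].
  move=> kt lt; rewrite neq_ltn => /orP[kl|lk] ku lu; first by apply: H; rewrite ?neq_ltn ?kl.
  by rewrite add_caretC ?neq_ltn ?lk ?orbT //; apply: H; rewrite ?neq_ltn ?lk.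
move=> kt lt _; have -> : bump k l = l.+1 by rewrite /bump; lia.
elim: t u k l kl kt lt => [|a IHa b IHb] u k l kl /=; first by case: k kl; case: l.
move=> kt lt; have [la|al] := ltnP l (leaves a).
  rewrite (ltn_trans kl la) /= !leaves_add_caret ltnS la.
  case: u => //= c d /andP[ac bd] /andP[ac' _]; rewrite bd andbT.
  exact: IHa (ltn_trans kl la) la ac ac'.
have [ka|ak] /= := ltnP k (leaves a).
  rewrite leaves_add_caret ltnS ltnNge al /= subSS.
  by case: u => //= c d /andP[-> _] /andP[_ ->].
rewrite !ltnNge (leqW al) /=; case: u => //= c d /andP[ac bd] /andP[_ bd'].
rewrite ac subSn //; apply: IHb bd bd'; lia.
Qed.

Record tree (n : nat) := Tree { tree_shape :> btree; tree_leaves : leaves tree_shape == n }.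

Lemma tree_inj n (s t : tree n) : s = t :> btree -> s = t.
Proof. case: s t => [s sn] [t tn] /= e; subst s; congr Tree; exact: bool_irrelevance. Qed.

Lemma tree_expand_subproof n (t : tree n) (k : 'I_n) : leaves (add_caret t k) == n.+1.
Proof. by rewrite leaves_add_caret (eqP (tree_leaves t)). Qed.

Definition tree_expand n (t : tree n) (k : 'I_n) : tree n.+1 :=
  Tree (tree_expand_subproof t k).

Record triple (n : nat) := Triple { tminus : tree n; tbraid : braid n; tplus : tree n }.

Definition expand n (x : triple n) (k : 'I_n) : triple n.+1 :=
  Triple (tree_expand (tminus x) (rho (tbraid x) k)) (bifurcate (tbraid x) k)
         (tree_expand (tplus x) k).

Definition rep : Type := {n & triple n}.

HB.instance Definition _ := gen_eqMixin rep.
HB.instance Definition _ := gen_choiceMixin rep.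

Inductive rep_eq : rep -> rep -> Prop :=
| re_expand n (x : triple n) k :
    rep_eq (existT triple n x) (existT triple n.+1 (expand x k))
| re_refl x : rep_eq x x
| re_sym x y : rep_eq x y -> rep_eq y x
| re_trans y x z : rep_eq x y -> rep_eq y z -> rep_eq x z.

Definition rep_eqb : rel rep := fun x y => `[< rep_eq x y >].

Lemma rep_eqb_equiv : equiv_class_of rep_eqb.
Proof.
split=> [x | x y | y x z].
- exact/asboolP/re_refl.
- by apply/asboolP/asboolP; apply: re_sym.
- by move=> /asboolP xy /asboolP yz; apply/asboolP; apply: re_trans yz.
Qed.

Canonical rep_equiv := EquivRelPack rep_eqb_equiv.

Definition bV : Type := {eq_quot rep_equiv}.

HB.instance Definition _ := Choice.on bV.
HB.instance Definition _ := EqQuotient.on bV.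

Definition bV_class n (a : tree n) (b : braid n) (c : tree n) : bV :=
  \pi_bV (existT triple n (Triple a b c)).

Notation "[bV a , b , c ]" := (bV_class a b c)
  (at level 0, a, b, c at level 99, format "[bV  a ,  b ,  c ]").

Lemma classP m a b c n a' b' c' :
  @bV_class m a b c = @bV_class n a' b' c' <->
  rep_eq (existT triple m (Triple a b c)) (existT triple n (Triple a' b' c')).
Proof.
rewrite /bV_class; split=> [/eqP|xy]; first by rewrite eqmodE => /asboolP.
by apply/eqP; rewrite eqmodE; apply/asboolP.
Qed.

Lemma bVW (P : bV -> Prop) :
  (forall n (a c : tree n) (b : braid n), P [bV a, b, c]) -> forall g, P g.
Proof. by move=> Pc g; rewrite -[g]reprK; case: (generic_quotient.repr g) => n [a b c]; apply: Pc. Qed.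

Lemma class_expand n (a c : tree n) (b : braid n) k :
  [bV a, b, c] = [bV tree_expand a (rho b k), bifurcate b k, tree_expand c k].
Proof. exact/classP/(re_expand (Triple a b c)). Qed.

Inductive expands (A : nat -> Type) (e : forall n, A n -> 'I_n -> A n.+1) :
  forall m n, A m -> A n -> Prop :=
| exp_refl n (x : A n) : expands e x x
| exp_step m n (x : A m) k (y : A n) : expands e (e m x k) y -> expands e x y.

Definition expansion_comm (A : nat -> Type) (e : forall n, A n -> 'I_n -> A n.+1) :=
  forall n (x : A n) (k l : 'I_n), k != l ->
    e _ (e _ x k) (shift k l) = e _ (e _ x l) (shift l k).

Lemma tree_expandC : expansion_comm tree_expand.
Proof.
move=> n t k l kl; apply: tree_inj; apply: add_caretC => //.
- by rewrite (eqP (tree_leaves t)).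
- by rewrite (eqP (tree_leaves t)).
Qed.

Lemma expandC : expansion_comm expand.
Proof.
move=> n [a b c] k l kl; rewrite /expand /=.
rewrite !rho_bifurcate_shift //; last by rewrite eq_sym.
by rewrite bifurcate_bifurcate // !(tree_expandC _ kl) tree_expandC // (inj_eq perm_inj).
Qed.

Lemma expands_trans (A : nat -> Type) (e : forall n, A n -> 'I_n -> A n.+1)
    m n p (x : A m) (y : A n) (z : A p) :
  expands e x y -> expands e y z -> expands e x z.
Proof. by elim=> // {}m {}n {}x k {}y _ IH /IH; apply: exp_step. Qed.

Lemma expands1 (A : nat -> Type) (e : forall n, A n -> 'I_n -> A n.+1)
    n (x : A n) k : expands e x (e _ x k).
Proof. exact/exp_step/exp_refl. Qed.

Lemma expands_strip (A : nat -> Type) (e : forall n, A n -> 'I_n -> A n.+1)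
    (eC : expansion_comm e) m n (x : A m) (y : A n) k :
  expands e x y -> exists p (w : A p), expands e (e _ x k) w /\ expands e y w.
Proof.
move=> xy; elim: xy k => {m n x y} [n x k|m n x l y xy IH k].
  by exists _, (e _ x k); split; [exact: exp_refl | exact: expands1].
have [->|kl] := eqVneq k l; first by exists _, y; split=> //; exact: exp_refl.
have [p [w [H1 H2]]] := IH (shift l k); exists p, w; split=> //.
by apply: (exp_step (k := shift k l)); rewrite eC.
Qed.

Lemma expands_confl (A : nat -> Type) (e : forall n, A n -> 'I_n -> A n.+1)
    (eC : expansion_comm e) m n p (x : A m) (y : A n) (z : A p) :
  expands e x y -> expands e x z ->
  exists q (w : A q), expands e y w /\ expands e z w.
Proof.
move=> xy xz; elim: xz n y xy => {m p x z} [m x n y xy|m p x k z _ IH n y xy].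
  by exists _, y; split=> //; exact: exp_refl.
have [q [w [kw yw]]] := expands_strip eC k xy.
have [r [v [wv zv]]] := IH _ _ kw.
by exists r, v; split=> //; apply: expands_trans wv.
Qed.

Lemma expands_size (A : nat -> Type) (e : forall n, A n -> 'I_n -> A n.+1)
    m n (x : A m) (y : A n) : expands e x y -> (m <= n)%N.
Proof. by elim=> // {}m {}n {}x k {}y _ /ltnW. Qed.

Lemma expands_eq (A : nat -> Type) (e : forall n, A n -> 'I_n -> A n.+1)
    n (x y : A n) : expands e x y -> x = y.
Proof.
suff H m p (x' : A m) (y' : A p) : expands e x' y' -> m = p -> existT A m x' = existT A p y'.
  by move=> /H/(_ erefl); apply: Eqdep_dec.inj_pair2_eq_dec; exact: PeanoNat.Nat.eq_dec.
case=> {m p x' y'} [//|m p x' k y' xy ep]; exfalso.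
by have := expands_size xy; rewrite ep ltnn.
Qed.

Lemma expands_inv (A : nat -> Type) (e : forall n, A n -> 'I_n -> A n.+1)
    m n (x : A m) (y : A n) : expands e x y ->
  m = n \/ exists k, expands e (e _ x k) y.
Proof. by case=> [|{}m {}n {}x k {}y xy]; [left | right; exists k]. Qed.

Lemma expands_btree_le m n (s : tree m) (t : tree n) :
  expands tree_expand s t -> btree_le s t.
Proof.
elim=> {m n s t} [n s|m n s k t _]; first exact: btree_le_refl.
exact/btree_le_trans/btree_le_add.
Qed.

Lemma btree_le_expands m n (s : tree m) (t : tree n) :
  btree_le s t -> expands tree_expand s t.
Proof.
have [d] := ubnP (n - m); elim: d m s => // d IH m s dm st.
have [est|[k ks kt]] := btree_le_step st.
  have emn : m = n by rewrite -(eqP (tree_leaves s)) est (eqP (tree_leaves t)).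
  case: n / emn t dm st est {IH} => t _ _ /tree_inj ->; exact: exp_refl.
rewrite (eqP (tree_leaves s)) in ks.
apply: (exp_step (k := Ordinal ks)); apply: IH => //.
have := btree_le_leaves kt; rewrite leaves_add_caret (eqP (tree_leaves s)) (eqP (tree_leaves t)); lia.
Qed.

Lemma tree_common m n (s : tree m) (t : tree n) :
  exists p (u : tree p), expands tree_expand s u /\ expands tree_expand t u.
Proof.
pose l := @Tree 1 Leaf (eqxx 1%N).
have ls : expands tree_expand l s by exact: btree_le_expands.
have lt : expands tree_expand l t by exact: btree_le_expands.
exact: (expands_confl tree_expandC ls lt).
Qed.

Lemma expands_tplus m n (x : triple m) (y : triple n) :
  expands expand x y -> expands tree_expand (tplus x) (tplus y).
Proof. elim=> {m n x y} [n x|m n x k y _]; [exact: exp_refl | exact: exp_step]. Qed.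

Lemma expands_lift_tplus m n (x : triple m) (t : tree n) :
  expands tree_expand (tplus x) t -> exists2 y : triple n, expands expand x y & tplus y = t.
Proof.
move es : (tplus x) => s st; elim: st x es => {m n s t} [n s|m n s k t _ IH] x es.
  by exists x => //; exact: exp_refl.
have [|y xy yt] := IH (expand x k); first by rewrite /= es.
by exists y => //; apply: exp_step xy.
Qed.

Definition triple_inv n (x : triple n) : triple n :=
  Triple (tplus x) (tbraid x)^-1 (tminus x).

Lemma triple_invK n : involutive (@triple_inv n).
Proof. by case=> a b c; rewrite /triple_inv /= invgK. Qed.

Lemma triple_inv_expand n (x : triple n) k :
  triple_inv (expand x k) = expand (triple_inv x) (rho (tbraid x) k).
Proof. by case: x => a b c; rewrite /triple_inv /expand /= rhoK bifurcateV. Qed.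

Lemma expands_inverse m n (x : triple m) (y : triple n) :
  expands expand x y -> expands expand (triple_inv x) (triple_inv y).
Proof.
elim=> {m n x y} [n x|m n x k y _]; first exact: exp_refl.
by rewrite triple_inv_expand; exact: exp_step.
Qed.

Lemma expands_lift_tminus m n (x : triple m) (t : tree n) :
  expands tree_expand (tminus x) t -> exists2 y : triple n, expands expand x y & tminus y = t.
Proof.
move=> xt; have [y xy yt] := @expands_lift_tplus _ _ (triple_inv x) t xt.
by exists (triple_inv y) => //; rewrite -[x]triple_invK; apply: expands_inverse.
Qed.

Lemma expands_tplus_inj m n (x : triple m) (y z : triple n) :
  expands expand x y -> expands expand x z -> tplus y = tplus z -> y = z.
Proof.
have [d] := ubnP (n - m); elim: d m x y z => // d IH m x y z dm xy xz eyz.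
have := expands_size xy; rewrite leq_eqVlt => /orP[/eqP emn|ltmn].
  by clear IH dm eyz; case: n / emn y z xy xz => y z xy xz; rewrite -(expands_eq xy) -(expands_eq xz).
have dm' : (n - m.+1 < d)%N by lia.
have [emn|[k ky]] := expands_inv xy; first by rewrite emn ltnn in ltmn.
have [emn|[l lz]] := expands_inv xz; first by rewrite emn ltnn in ltmn.
have [ekl|kl] := eqVneq k l.
  by subst l; apply: (IH _ _ _ _ dm' ky lz).
have tk := expands_btree_le (expands_tplus ky).
have tl := expands_btree_le (expands_tplus lz).
have /btree_le_expands/expands_lift_tplus[w kw ew] :
    btree_le (tplus (expand (expand x k) (shift k l))) (tplus y).
  apply: btree_le_join => //; rewrite ?(eqP (tree_leaves (tplus x))) //.
  by rewrite eyz.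
have yw : y = w by apply: (IH _ _ _ _ dm' ky (exp_step kw)).
have zw : z = w.
  apply: (IH _ _ _ _ dm' lz); last by rewrite ew eyz.
  by apply: (exp_step (k := shift l k)); rewrite -expandC.
by rewrite yw zw.
Qed.

Definition rep_expands (x y : rep) := expands expand (projT2 x) (projT2 y).

Lemma rep_eqP (x y : rep) :
  rep_eq x y -> exists z : rep, rep_expands x z /\ rep_expands y z.
Proof.
rewrite /rep_expands; elim=> {x y} [n x k|x|x y _ [z [xz yz]]|y x z _ [u [xu yu]] _ [v [yv zv]]].
- exists (existT _ _ (expand x k)); split; [exact: expands1 | exact: exp_refl].
- by exists x; split; exact: exp_refl.
- by exists z.
- have [p [w [uw vw]]] := expands_confl expandC yu yv.
  by exists (existT _ p w); split; [exact: expands_trans uw | exact: expands_trans vw].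
Qed.

Lemma class_expands m n (x : triple m) (y : triple n) : expands expand x y ->
  [bV tminus x, tbraid x, tplus x] = [bV tminus y, tbraid y, tplus y].
Proof. by elim=> {m n x y} // m n [a b c] k y _ <-; exact: class_expand. Qed.

Lemma class_eqP m n a b c a' b' c' : @bV_class m a b c = @bV_class n a' b' c' ->
  exists p (z : triple p), expands expand (Triple a b c) z /\ expands expand (Triple a' b' c') z.
Proof. by move=> /classP/rep_eqP[[p z] /= H]; exists p, z. Qed.

Lemma expands_composable m n (a c d : tree m) (b g : braid m) (y : triple n) :
  expands expand (Triple c g d) y ->
  exists (a' : tree n) (b' : braid n),
    expands expand (Triple a b c) (Triple a' b' (tminus y)) /\
    expands expand (Triple a (b * g) d) (Triple a' (b' * tbraid y) (tplus y)).
Proof.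
move ex : (Triple c g d) => x xy.
elim: xy a b c g d ex => {m n x y} [n x|m n x k y _ IH] a b c g d ex.
  by subst x; exists a, b; split; exact: exp_refl.
subst x; have [a' [b' [H1 H2]]] :=
  IH (tree_expand a (rho b (rho g k))) (bifurcate b (rho g k)) _ _ _ erefl.
exists a', b'; split; first by apply: (exp_step (k := rho g k)).
by apply: (exp_step (k := k)); rewrite /expand /= rhoM bifurcateM.
Qed.

Lemma expands_tminus m n (x : triple m) (y : triple n) :
  expands expand x y -> expands tree_expand (tminus x) (tminus y).
Proof. by move/expands_inverse/expands_tplus. Qed.

Lemma composable_step m n (x0 y0 : triple m) (x y : triple n) :
  tplus x0 = tminus y0 -> expands expand x0 x ->
  tplus x = tminus y -> expands expand y0 y ->
  [bV tminus x0, tbraid x0 * tbraid y0, tplus y0] =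
  [bV tminus x, tbraid x * tbraid y, tplus y].
Proof.
case: x0 y0 => [a b c] [c' g d] /= ec; subst c' => xx exy yy.
have [a1 [b1 [X1 Z1]]] := expands_composable a b yy.
have -> := expands_tplus_inj xx X1 exy.
exact: class_expands Z1.
Qed.

Lemma composable_eq m n (a c d : tree m) (b g : braid m) (a' c' d' : tree n) (b' g' : braid n) :
  [bV a, b, c] = [bV a', b', c'] -> [bV c, g, d] = [bV c', g', d'] ->
  [bV a, b * g, d] = [bV a', b' * g', d'].
Proof.
move=> /class_eqP[p [x [xx xx']]] exy.
have [y1 yy1 ey1] := @expands_lift_tminus _ _ (Triple c g d) _ (expands_tplus xx).
have [y1' yy1' ey1'] := @expands_lift_tminus _ _ (Triple c' g' d') _ (expands_tplus xx').
have : [bV tminus y1, tbraid y1, tplus y1] = [bV tminus y1', tbraid y1', tplus y1'].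
  by rewrite -(class_expands yy1) -(class_expands yy1').
move=> /class_eqP[q [y [y1y y1y']]].
have yy : expands expand (Triple c g d) y.
  by apply: expands_trans yy1 _; case: (y1) y1y.
have yy' : expands expand (Triple c' g' d') y.
  by apply: expands_trans yy1' _; case: (y1') y1y'.
have [|x2 xx2 ex2] := @expands_lift_tplus _ _ x (tminus y).
  by rewrite -ey1; apply: (expands_tminus y1y).
rewrite (composable_step (x0 := Triple a b c) _ (expands_trans xx xx2) ex2 yy) //.
by rewrite (composable_step (x0 := Triple a' b' c') _ (expands_trans xx' xx2) ex2 yy').
Qed.

Lemma bV_composable (x y : bV) :
  exists n (a c d : tree n) (b g : braid n), x = [bV a, b, c] /\ y = [bV c, g, d].
Proof.
elim/bVW: x => m a c b; elim/bVW: y => n c' d g.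
have [p [t [ct ct']]] := tree_common c c'.
have [x xx ex] := @expands_lift_tplus _ _ (Triple a b c) _ ct.
have [y yy ey] := @expands_lift_tminus _ _ (Triple c' g d) _ ct'.
exists p, (tminus x), t, (tplus y), (tbraid x), (tbraid y).
by rewrite -{1}ex -{1}ey -(class_expands xx) -(class_expands yy).
Qed.

Record composable : Type := Composable {
  cwidth : nat; ctree1 : tree cwidth; ctree2 : tree cwidth; ctree3 : tree cwidth;
  cbraid1 : braid cwidth; cbraid2 : braid cwidth }.

Lemma composable_exists (x y : bV) : exists c : composable,
  x = [bV ctree1 c, cbraid1 c, ctree2 c] /\ y = [bV ctree2 c, cbraid2 c, ctree3 c].
Proof.
have [n [a [c [d [b [g xy]]]]]] := bV_composable x y.
by exists (Composable a c d b g).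
Qed.

(* The result does not depend on the chosen composable pair of triples, see
   bV_mulE. *)
Definition bV_mul (x y : bV) : bV :=
  let c := projT1 (cid (composable_exists x y)) in
  [bV ctree1 c, cbraid1 c * cbraid2 c, ctree3 c].

Lemma bV_mulE n (a c d : tree n) (b g : braid n) :
  bV_mul [bV a, b, c] [bV c, g, d] = [bV a, b * g, d].
Proof.
rewrite /bV_mul; case: cid => p /= [ex ey]; exact: (esym (composable_eq ex ey)).
Qed.

Definition trivial_tree : tree 1 := @Tree 1 Leaf (eqxx 1%N).

Definition bV_one : bV := [bV trivial_tree, 1, trivial_tree].

Lemma bV_oneE n (t : tree n) : bV_one = [bV t, 1, t].
Proof.
have : expands tree_expand trivial_tree t by exact: btree_le_expands.
rewrite /bV_one; move: (trivial_tree) => s; elim=> {n t} // m n {}s k t _ <-.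
by rewrite (class_expand _ _ _ k) rho1 bifurcate1.
Qed.

Definition bV_inv (x : bV) : bV :=
  let r := projT2 (generic_quotient.repr x) in [bV tplus r, (tbraid r)^-1, tminus r].

Lemma bV_invE n (a c : tree n) (b : braid n) :
  bV_inv [bV a, b, c] = [bV c, b^-1, a].
Proof.
rewrite /bV_inv; set r := generic_quotient.repr _.
have : \pi_bV r = [bV a, b, c] by rewrite reprK.
case: r => m [a' b' c'] /= /class_eqP[p [z [z1 z2]]].
have := class_expands (expands_inverse z1).
by rewrite (class_expands (expands_inverse z2)) /= => ->.
Qed.

Lemma bV_mul1g : left_id bV_one bV_mul.
Proof. by elim/bVW=> n a c b; rewrite (bV_oneE a) bV_mulE mul1g. Qed.

Lemma bV_mulg1 : right_id bV_one bV_mul.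
Proof. by elim/bVW=> n a c b; rewrite (bV_oneE c) bV_mulE mulg1. Qed.

Lemma bV_mulVg : left_inverse bV_one bV_inv bV_mul.
Proof. by elim/bVW=> n a c b; rewrite (bV_oneE c) bV_invE bV_mulE mulVg. Qed.

Lemma bV_mulgV : right_inverse bV_one bV_inv bV_mul.
Proof. by elim/bVW=> n a c b; rewrite (bV_oneE a) bV_invE bV_mulE mulgV. Qed.

Lemma bV_mulA : associative bV_mul.
Proof.
move=> x y z; have [n [c [d [e [g [h [-> ->]]]]]]] := bV_composable y z.
elim/bVW: x => m a c' b.
have [p [t [ct ct']]] := tree_common c c'.
have [x xx ex] := @expands_lift_tplus _ _ (Triple a b c') _ ct'.
have [y1 yy ey] := @expands_lift_tminus _ _ (Triple c g d) _ ct.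
have [z1 zz ez] := @expands_lift_tminus _ _ (Triple d h e) _ (expands_tplus yy).
rewrite (class_expands xx) (class_expands yy) (class_expands zz) /= ex ey ez.
by rewrite !bV_mulE mulgA.
Qed.

HB.instance Definition _ := isGroup.Build bV
  bV_mulA bV_mul1g bV_mulg1 bV_mulVg bV_mulgV.

(* Main.v *)
From HB Require Import structures.
Require Import Defs.
From mathcomp Require Import all_boot all_order all_algebra all_fingroup.
From mathcomp Require Import boolp zify ring lra.

Set Implicit Arguments.
Unset Strict Implicit.
Unset Printing Implicit Defensive.

Import Order.TTheory GRing.Theory Num.Theory.
Local Open Scope group_scope.

(** The proof measures how far an element of bV turns the boundary of the disk,
    which is the Dehornoy floor of a braid up to a bounded error, and shows
    that this amount is almost additive, hence bounded on products of at most
    N commutators, while it is unbounded on bV.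

    The braid group on n strands acts on the free group on x_0, ..., x_(n-1) by
    the Hurwitz moves (x_i, x_(i+1)) -> (x_i x_(i+1) x_i^-1, x_i), and fixes
    d = x_0 ... x_(n-1).  Topologically the free group is the fundamental group
    of the punctured disk, based on the boundary.  It carries a left invariant
    circular order, seen on the circle at infinity, and braids preserve it
    because they come from homeomorphisms.  Cut at the identity, the circular
    order is a linear order on which left multiplication by d is a translation
    away from the powers of d, and this translation commutes with the braid
    action.  Groups that act on a line and commute with a translation have
    almost additive displacement.

    The circular order is obtained from a ping-pong model: x_i is a parabolic
    matrix of SL_2(Z), and words are compared by their values at infinity.  In
    any ping-pong configuration with the same arrangement of intervals two
    reduced words compare in the same way, since after removal of their common
    prefix only first letters matter ([ping_pong_circ_eval]).  Invariance under
    a Hurwitz move thus amounts to a new choice of intervals for the new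
    generators ([ping_pong_hurwitz_move]).

    Bifurcation of strand k corresponds to the substitution that replaces x_k
    by x_k x_(k+1) and shifts the later generators.  It fixes d and also
    preserves the order ([ping_pong_fuse]), so that displacement makes sense on
    bV.  As a reference point serves the product of the generators at the
    leaves below the left child of the root, which does not change when the
    tree is expanded ([triple_shift_expand]).

    The displacement of a commutator is bounded by an absolute constant
    ([bV_shift_comm]), whereas m full twists of two strands act on x_0 as
    conjugation by d ^ m, and move it about m steps ([full_twists_shift]). *)

(** * The circular order on SL_2(Z) *)
Record sl2z : Type := SL2Z {
  m00 : int; m01 : int; m10 : int; m11 : int;
  sl2z_det : (m00 * m11 - m01 * m10 == 1)%R }.

HB.instance Definition _ := gen_eqMixin sl2z.
HB.instance Definition _ := gen_choiceMixin sl2z.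

Lemma sl2z_eq (x y : sl2z) :
  m00 x = m00 y -> m01 x = m01 y -> m10 x = m10 y -> m11 x = m11 y -> x = y.
Proof.
case: x y => a b c d e [a' b' c' d' e'] /= ? ? ? ?; subst.
by congr SL2Z; apply: bool_irrelevance.
Qed.

Fact sl2z_mul_det (x y : sl2z) :
  ((m00 x * m00 y + m01 x * m10 y) * (m10 x * m01 y + m11 x * m11 y) -
   (m00 x * m01 y + m01 x * m11 y) * (m10 x * m00 y + m11 x * m10 y) == 1)%R.
Proof.
have /eqP ex := sl2z_det x; have /eqP ey := sl2z_det y.
by apply/eqP; rewrite -[RHS]mulr1 -{1}ex -ey; ring.
Qed.

Definition sl2z_mul x y := SL2Z (sl2z_mul_det x y).

Definition sl2z_one : sl2z := @SL2Z 1 0 0 1 isT.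

Fact sl2z_inv_det (x : sl2z) : (m11 x * m00 x - - m01 x * - m10 x == 1)%R.
Proof. by rewrite mulrNN mulrC; exact: sl2z_det. Qed.

Definition sl2z_inv x := SL2Z (sl2z_inv_det x).

Fact sl2z_mulA : associative sl2z_mul.
Proof. by move=> x y z; apply: sl2z_eq => /=; ring. Qed.

Fact sl2z_mul1g : left_id sl2z_one sl2z_mul.
Proof. by move=> x; apply: sl2z_eq => /=; ring. Qed.

Fact sl2z_mulg1 : right_id sl2z_one sl2z_mul.
Proof. by move=> x; apply: sl2z_eq => /=; ring. Qed.

Fact sl2z_mulVg : left_inverse sl2z_one sl2z_inv sl2z_mul.
Proof.
by move=> x; have /eqP e := sl2z_det x; apply: sl2z_eq => /=; rewrite -?e; ring.
Qed.

Fact sl2z_mulgV : right_inverse sl2z_one sl2z_inv sl2z_mul.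
Proof.
by move=> x; have /eqP e := sl2z_det x; apply: sl2z_eq => /=; rewrite -?e; ring.
Qed.

HB.instance Definition _ := isGroup.Build sl2z
  sl2z_mulA sl2z_mul1g sl2z_mulg1 sl2z_mulVg sl2z_mulgV.

(** A matrix stands for the point of the rational projective line to which it
    sends infinity, that is, for the slope of its first column. *)
Definition coldet (x y : sl2z) : int := (m00 x * m10 y - m10 x * m00 y)%R.

(** The three points are distinct and in counterclockwise order.  The product
    of determinants does not change when a column changes sign, so it depends
    only on the points. *)
Definition circ (x y z : sl2z) : bool :=
  (0 < coldet x y * coldet y z * coldet z x)%R.

(** The usual order of the rational line, which is the circle cut at infinity:
    both points are finite, and the first is smaller. *)
Definition before (x y : sl2z) : bool := circ 1 x y.

Lemma coldetM g x y : coldet (g * x) (g * y) = coldet x y.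
Proof.
have /eqP e := sl2z_det g; rewrite /coldet /= -[RHS]mulr1 -e; ring.
Qed.

Lemma circM g x y z : circ (g * x) (g * y) (g * z) = circ x y z.
Proof. by rewrite /circ !coldetM. Qed.

Lemma circ_rot x y z : circ x y z = circ y z x.
Proof. by rewrite /circ -mulrA mulrC. Qed.

Lemma circ_asym x y z : circ x y z -> ~~ circ x z y.
Proof.
rewrite /circ => h; rewrite -leNgt -oppr_ge0; apply: ltW.
by have -> // : (- (coldet x z * coldet z y * coldet y x) =
  coldet x y * coldet y z * coldet z x)%R by rewrite /coldet; ring.
Qed.

Lemma circ_xyy x y : ~~ circ x y y.
Proof. by apply/negP => h; have := circ_asym h; rewrite h. Qed.

Lemma beforeE x y : before x y =
  (0 < m10 x * m10 y * (m10 x * m00 y - m00 x * m10 y))%R.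
Proof. by rewrite /before /circ /coldet /=; congr (0 < _)%R; ring. Qed.

Lemma before_fin x y : before x y -> m10 x != 0%R /\ m10 y != 0%R.
Proof.
rewrite beforeE => h; split; apply: contraTneq h => ->.
- by rewrite !mul0r ltxx.
- by rewrite mulr0 mul0r ltxx.
Qed.

Lemma before_irr x : ~~ before x x.
Proof. exact: circ_xyy. Qed.

Lemma before_trans y x z : before x y -> before y z -> before x z.
Proof.
move=> xy yz; have [x0 y0] := before_fin xy; have [_ z0] := before_fin yz.
move: xy yz; rewrite !beforeE => h1 h2.
have sq (t : int) : t != 0%R -> (0 < t ^+ 2)%R by move=> t0; rewrite exprn_even_gt0.
rewrite -(pmulr_rgt0 _ (sq _ y0)).
have := addr_gt0 (mulr_gt0 (sq _ z0) h1) (mulr_gt0 (sq _ x0) h2).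
by congr (0 < _)%R; ring.
Qed.

(** The form of totality that does not require a decision of equality of
    points. *)
Lemma before_cotrans y x z : m10 y != 0%R -> before x z -> before x y || before y z.
Proof.
move=> y0 xz; apply: contraT; rewrite negb_or !beforeE -!leNgt => /andP[h1 h2].
have [x0 z0] := before_fin xz; move: xz; rewrite beforeE => h3.
have sq (t : int) : t != 0%R -> (0 < t ^+ 2)%R by move=> t0; rewrite exprn_even_gt0.
have := mulr_gt0 (sq _ y0) h3; rewrite ltNge => /negP[].
have := lerD (mulr_ge0_le0 (ltW (sq _ z0)) h1) (mulr_ge0_le0 (ltW (sq _ x0)) h2).
by rewrite addr0; congr (_ <= 0)%R; ring.
Qed.

(** By left invariance the common point x can be moved to infinity, where the
    claim is transitivity of the linear order. *)
Lemma circ_trans x y z w : circ x y z -> circ x z w -> circ x y w.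
Proof.
have base u v : circ x u v = before (x^-1 * u) (x^-1 * v).
  by rewrite -(circM x^-1) mulVg.
by rewrite !base; exact: before_trans.
Qed.

Lemma circ_before x y z : before x y -> before y z -> circ x y z.
Proof.
rewrite /before => xy yz; rewrite circ_rot; apply: (@circ_trans _ _ 1).
  by rewrite -circ_rot.
by rewrite -circ_rot -circ_rot.
Qed.

(** * Words and ping-pong *)

(** The letter (i, b) is the generator x_i if b is true and its inverse
    otherwise. *)
Definition letter : Type := (nat * bool)%type.

Definition letter_inv (l : letter) : letter := (l.1, ~~ l.2).

Lemma letter_invK : involutive letter_inv.
Proof. by case=> i b; rewrite /letter_inv negbK. Qed.

Definition letter_val (G : groupType) (h : nat -> G) (l : letter) : G :=
  if l.2 then h l.1 else (h l.1)^-1.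

Definition eval (G : groupType) (h : nat -> G) (u : seq letter) : G :=
  \prod_(l <- u) letter_val h l.

Lemma eval_nil (G : groupType) (h : nat -> G) : eval h [::] = 1.
Proof. exact: big_nil. Qed.

Lemma eval_cons (G : groupType) (h : nat -> G) l u : eval h (l :: u) = letter_val h l * eval h u.
Proof. exact: big_cons. Qed.

Lemma eval_cat (G : groupType) (h : nat -> G) u v : eval h (u ++ v) = eval h u * eval h v.
Proof. exact: big_cat. Qed.

Lemma letter_valV (G : groupType) (h : nat -> G) l :
  letter_val h (letter_inv l) = (letter_val h l)^-1.
Proof. by case: l => i [] //=; rewrite /letter_val /= invgK. Qed.

Definition reduced : pred (seq letter) := sorted (fun l m => m != letter_inv l).

Definition reduce_cons (l : letter) (u : seq letter) : seq letter :=
  if u is m :: v then if m == letter_inv l then v else l :: u else [:: l].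

Definition reduce : seq letter -> seq letter := foldr reduce_cons [::].

Lemma reduce_reduced u : reduced (reduce u).
Proof.
elim: u => //= l u; case: (reduce u) => //= m v mv.
case: eqP => [_|/eqP ml]; last by rewrite /= ml.
by apply: path_sorted mv.
Qed.

Lemma eval_reduce (G : groupType) (h : nat -> G) u : eval h (reduce u) = eval h u.
Proof.
elim: u => //= l u; rewrite eval_cons => <-.
case: (reduce u) => [|m v] /=; first by rewrite eval_cons.
by case: eqP => [->|_]; rewrite !eval_cons // letter_valV mulVKg.
Qed.

(** The intervals are arranged along the line as those of x_0, x_0^-1, x_1,
    x_1^-1 and so on, and the slot of a letter numbers its interval.  Slot 0 is
    the point at infinity, and slot 1 lies to the left of all intervals of
    letters. *)
Definition slot (l : letter) : nat := (l.1.*2.+2 + ~~ l.2)%N.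

Lemma slot_inj : injective slot.
Proof.
move=> [i b] [j c]; rewrite /slot /= => e.
have ebc : b = c by move: b c e => [] []; lia.
by move: e; rewrite ebc => e; congr (_, _); lia.
Qed.

(** The circular order of the slots. *)
Definition ccw (p s t : nat) : bool := [|| p < s < t, s < t < p | t < p < s]%N.

(** The function pos cuts the circle into consecutive intervals, with infinity
    alone at 0, and each letter maps the complement of the interval of its
    inverse into its own interval. *)
Definition ping_pong (h : nat -> sl2z) (pos : sl2z -> nat) : Prop :=
  [/\ pos 1 = 0%N,
      forall x, pos x = 0%N -> forall y z, circ x y z = circ 1 y z,
      forall x y, (0 < pos x < pos y)%N -> before x y &
      forall l x, pos x != slot (letter_inv l) -> pos (letter_val h l * x) = slot l].

Lemma ping_pong_circ h pos x y z : ping_pong h pos ->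
  ccw (pos x) (pos y) (pos z) -> circ x y z.
Proof.
case=> _ H0 Hlt _.
have key u v w : (pos u < pos v < pos w)%N -> circ u v w.
  case/andP=> uv vw; case: (posnP (pos u)) => [u0|u_gt0].
    by rewrite (H0 _ u0); apply: Hlt; rewrite vw (leq_trans _ uv).
  apply: circ_before; apply: Hlt; first by rewrite u_gt0.
  by rewrite vw (ltn_trans u_gt0).
by case/or3P=> /key //; rewrite -circ_rot // -circ_rot.
Qed.

Definition head_slot (u : seq letter) : nat := if u is l :: _ then slot l else 0%N.

Lemma ping_pong_head h pos u : ping_pong h pos -> reduced u -> pos (eval h u) = head_slot u.
Proof.
case=> p1 _ _ pp; elim: u => [|l u IH] /=; first by rewrite eval_nil.
move=> lu; rewrite eval_cons; apply: pp; rewrite IH; last exact: path_sorted lu.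
by case: u lu {IH} => [|m u] //= /andP[ml _]; rewrite (inj_eq slot_inj).
Qed.

Lemma ping_pong_circE h pos h' pos' x y z x' y' z' :
    ping_pong h pos -> ping_pong h' pos' ->
    pos x = pos' x' -> pos y = pos' y' -> pos z = pos' z' ->
    pos x != pos y -> pos x != pos z -> pos y != pos z ->
  circ x y z = circ x' y' z'.
Proof.
move=> pph pph' ex ey ez xy xz yz.
have : ccw (pos x) (pos y) (pos z) || ccw (pos x) (pos z) (pos y) by rewrite /ccw; lia.
case/orP=> hc.
  by rewrite (ping_pong_circ pph hc); apply/esym/(ping_pong_circ pph'); rewrite -ex -ey -ez.
have /circ_asym/negbTE -> := ping_pong_circ pph hc.
by apply/esym/negbTE/circ_asym/(ping_pong_circ pph'); rewrite -ex -ey -ez.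
Qed.

(** Two points at infinity coincide, and then no triple is in order. *)
Lemma ping_pong_circ0 h pos x y z : ping_pong h pos ->
  pos x = 0%N -> pos y = 0%N -> circ x y z = false /\ circ x z y = false.
Proof.
case=> _ H0 _ _ x0 y0; have f : circ z 1 1 = false by apply/negbTE/circ_xyy.
rewrite !(H0 _ x0); split; first by rewrite circ_rot (H0 _ y0) circ_rot.
by rewrite -circ_rot (H0 _ y0) -circ_rot.
Qed.

(** The circular order of the values of words is the same in all ping-pong
    configurations.  A common first letter l of u and v can be cancelled by
    left invariance, at the price of moving z into the interval of the inverse
    of l; the remaining words are reduced and do not start with that inverse,
    so the condition on z is preserved.  Once the first letters differ, the
    three points lie in three different intervals, unless two of them are at
    infinity. *)
Lemma ping_pong_circ_eval h pos h' pos' u v z z' :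
    ping_pong h pos -> ping_pong h' pos' ->
    reduced u -> reduced v -> pos z = pos' z' ->
    pos z = 0%N \/ pos z != head_slot u /\ pos z != head_slot v ->
  circ z (eval h u) (eval h v) = circ z' (eval h' u) (eval h' v).
Proof.
move=> pph pph'.
have distinct w w' y y' : reduced w -> reduced w' -> head_slot w != head_slot w' ->
    pos y = pos' y' -> pos y = 0%N \/ pos y != head_slot w /\ pos y != head_slot w' ->
    circ y (eval h w) (eval h w') = circ y' (eval h' w) (eval h' w').
  move=> rw rw' nww' eyy' yww'.
  have pw := ping_pong_head pph rw; have pw' := ping_pong_head pph rw'.
  have qw := ping_pong_head pph' rw; have qw' := ping_pong_head pph' rw'.
  have zero : pos y = 0%N -> head_slot w = 0%N \/ head_slot w' = 0%N ->
      circ y (eval h w) (eval h w') = circ y' (eval h' w) (eval h' w').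
    move=> y0 [w0|w0]; have y0' : pos' y' = 0%N by rewrite -eyy'.
      have [-> _] := ping_pong_circ0 (eval h w') pph y0 (etrans pw w0).
      by have [-> _] := ping_pong_circ0 (eval h' w') pph' y0' (etrans qw w0).
    have [_ ->] := ping_pong_circ0 (eval h w) pph y0 (etrans pw' w0).
    by have [_ ->] := ping_pong_circ0 (eval h' w) pph' y0' (etrans qw' w0).
  have [y_w|nyw] := eqVneq (pos y) (head_slot w); first by apply: zero; lia.
  have [y_w'|nyw'] := eqVneq (pos y) (head_slot w'); first by apply: zero; lia.
  by apply: (ping_pong_circE pph pph'); rewrite ?pw ?pw' ?qw ?qw'.
elim: u v z z' => [|l u IH] v z z' ru rv ezz' zuv.
  case: v rv zuv => [|m v] rv zuv; last exact: distinct.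
  by rewrite !(negbTE (circ_xyy _ _)).
case: v rv zuv => [|m v] rv zuv; first exact: distinct.
have [elm|nlm] := eqVneq l m; last by apply: distinct; rewrite // (inj_eq slot_inj).
subst m; have zl : pos z != slot l by case: zuv => [->|[]].
rewrite !eval_cons.
have step g (w w' w'' : sl2z) :
    circ w (letter_val g l * w') (letter_val g l * w'') =
    circ (letter_val g (letter_inv l) * w) w' w''.
  by rewrite -(circM (letter_val g (letter_inv l))) letter_valV !mulKg.
have el : pos (letter_val h (letter_inv l) * z) = slot (letter_inv l).
  by case: pph => _ _ _; apply; rewrite letter_invK.
have el' : pos' (letter_val h' (letter_inv l) * z') = slot (letter_inv l).
  by case: pph' => _ _ _; apply; rewrite letter_invK -ezz'.
have sl w : reduced (l :: w) -> slot (letter_inv l) != head_slot w.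
  by case: w => [|m w] //= /andP[ml _]; rewrite (inj_eq slot_inj) eq_sym.
rewrite !step; apply: IH; rewrite ?el ?el' //.
- exact: path_sorted ru.
- exact: path_sorted rv.
- by right; split; apply: sl.
Qed.

Lemma ping_pong_before h pos h' pos' u v : ping_pong h pos -> ping_pong h' pos' ->
  before (eval h u) (eval h v) = before (eval h' u) (eval h' v).
Proof.
move=> pph pph'; rewrite -!(eval_reduce _ u) -!(eval_reduce _ v) /before.
have [p1 _ _ _] := pph; have [p1' _ _ _] := pph'.
apply: (ping_pong_circ_eval pph pph'); rewrite ?p1 ?p1' //; try exact: reduce_reduced.
by left.
Qed.

(** * A ping-pong configuration of parabolic matrices *)
Fact parabolic_det (m : int) :
  ((1 - 2 * m) * (1 + 2 * m) - 2 * m ^+ 2 * - 2 == 1)%R.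
Proof. by apply/eqP; ring. Qed.

(** The parabolic matrix that fixes m; in the coordinate 1 / (x - m) it is the
    translation by -2. *)
Definition parabolic (m : int) : sl2z := SL2Z (parabolic_det m).

(** The coordinate 1 / (x - m) exceeds 1 exactly for x strictly between m and
    m + 1, and translation by -2 sends its other values to values at most -1,
    that is, to points of the interval from m - 1 to m.  Hence x_i pushes the
    complement of the interval from 2i + 1 to 2i + 2 into the interval from 2i
    to 2i + 1, and these intervals tile the half-line of nonnegative
    numbers. *)
Definition parabolics (i : nat) : sl2z := parabolic (i.*2.+1)%:Z.

(** Position 0 is infinity, position 1 the negative numbers, and position k + 2
    the points with integral part k.  The fraction p / q is rewritten as
    p q / q ^ 2 to make the denominator positive. *)
Definition position (x : sl2z) : nat :=
  let p := m00 x in let q := m10 x in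
  if q == 0%R then 0%N else
  if (p * q < 0)%R then 1%N else (absz (p * q %/ q ^+ 2)%Z).+2.

Lemma position_floor x k : position x = k.+2 <->
  m10 x != 0%R /\ (Posz k * m10 x ^+ 2 <= m00 x * m10 x < (Posz k + 1) * m10 x ^+ 2)%R.
Proof.
rewrite /position; set p := m00 x; set q := m10 x.
have [q0|q0] := eqVneq q 0%R; first by split=> [|[]].
have : (0 < q ^+ 2)%R by rewrite exprn_even_gt0.
move: (p * q)%R (q ^+ 2)%R => P Q Q0.
case: ltP => P0.
  by split=> // -[_ /andP[h _]]; move: (le_lt_trans h P0); rewrite ltNge mulr_ge0 // ltW.
have d0 : (0 <= (P %/ Q)%Z)%R by rewrite divz_ge0.
split=> [[<-]|[_ /andP[h1 h2]]].
  split=> //; rewrite gez0_abs // {2 3}(divz_eq P Q) lerDl modz_ge0 ?lt0r_neq0 //=.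
  by rewrite mulrDl mul1r ltrD2l ltz_pmod.
suff -> : (P %/ Q)%Z = Posz k by [].
rewrite -(subrK (Posz k * Q) P)%R addrC divzMDl ?lt0r_neq0 // divz_small ?addr0 //.
rewrite (gez0_abs (ltW Q0)) subr_ge0 h1 /= ltrBlDr addrC; by rewrite mulrDl mul1r in h2.
Qed.

Lemma position0 x : position x = 0%N -> m10 x = 0%R.
Proof. by rewrite /position; case: eqP => // _; case: ifP. Qed.

Lemma position1 x : position x = 1%N -> m10 x != 0%R /\ (m00 x * m10 x < 0)%R.
Proof. by rewrite /position; case: eqP => // _; case: ltP. Qed.

Lemma position_before x y : (0 < position x < position y)%N -> before x y.
Proof.
case/andP; case ex : (position x) => [//|k] _; case ey : (position y) => [//|l].
rewrite ltnS; case: l ey => // l /position_floor[y0 /andP[y1 _]] kl.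
suff : (0 < m10 x ^+ 2 * (m00 y * m10 y) - m00 x * m10 x * m10 y ^+ 2)%R.
  by rewrite beforeE; congr (0 < _)%R; ring.
have Qy : (0 < m10 y ^+ 2)%R by rewrite exprn_even_gt0.
move: y1 Qy; move: (m00 y * m10 y)%R (m10 y ^+ 2)%R => P Q PQ Q0.
case: k ex kl => [/position1[x0 xneg] _|k /position_floor[x0 /andP[_ x2]] kl].
  have Qx : (0 < m10 x ^+ 2)%R by rewrite exprn_even_gt0.
  have P0 : (0 <= P)%R by apply: le_trans PQ; rewrite mulr_ge0 // ltW.
  by rewrite subr_gt0; apply: lt_le_trans (mulr_ge0 (ltW Qx) P0); rewrite pmulr_llt0.
have Qx : (0 < m10 x ^+ 2)%R by rewrite exprn_even_gt0.
move: x2 Qx; move: (m00 x * m10 x)%R (m10 x ^+ 2)%R => P' Q' P'Q' Q'0.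
have kl' : (Posz k + 1 <= Posz l)%R by lia.
rewrite subr_gt0; apply: (@lt_le_trans _ _ ((Posz k + 1) * Q' * Q)%R).
  by rewrite ltr_pM2r.
apply: (@le_trans _ _ (Posz l * Q * Q')%R); last by rewrite mulrC ler_pM2l.
by rewrite -!mulrA [(Q' * Q)%R]mulrC ler_pM2r // mulr_gt0.
Qed.

(** The two ping-pong inclusions, in homogeneous coordinates: t / q is the
    difference from the fixed point, and the matrix sends (t, q) to
    (t, q - 2 t), its inverse to (t, q + 2 t). *)
Lemma parabolic_attract (t q : int) : (t != 0)%R || (q != 0)%R ->
  ~ (q != 0 /\ 0 <= t * q < q ^+ 2)%R ->
  (t * (q - 2 * t) < 0 /\ 0 <= (q - 2 * t) * (q - t))%R.
Proof.
move=> tq0 H; have [q0|q0] := eqVneq q 0%R.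
  subst q; rewrite eqxx orbF in tq0.
  have : (0 < t ^+ 2)%R by rewrite exprn_even_gt0.
  by nra.
have Q : (0 < q ^+ 2)%R by rewrite exprn_even_gt0.
have T : (0 <= t ^+ 2)%R by rewrite exprn_even_ge0.
have [tq|tq] := ltP (t * q)%R 0%R; first by split; nra.
have {}tq : (q ^+ 2 <= t * q)%R by rewrite leNgt; apply/negP => h; apply: H; rewrite tq h.
have : (0 <= (t - q) * t)%R.
  rewrite -(pmulr_rge0 _ Q).
  have -> : (q ^+ 2 * ((t - q) * t) = (t * q - q ^+ 2) * (t * q))%R by ring.
  by apply: mulr_ge0; lra.
have : (0 < t * q)%R by lra.
have : (0 <= (t - q) ^+ 2)%R by rewrite exprn_even_ge0.
by split; nra.
Qed.

Lemma parabolic_attractV (t q : int) : (t != 0)%R || (q != 0)%R ->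
  ~ (q != 0 /\ - q ^+ 2 <= t * q < 0)%R ->
  (0 <= t * (q + 2 * t) /\ 0 < (q + 2 * t) * (q + t))%R.
Proof.
move=> tq0 H; have [q0|q0] := eqVneq q 0%R.
  subst q; rewrite eqxx orbF in tq0.
  have : (0 < t ^+ 2)%R by rewrite exprn_even_gt0.
  by nra.
have Q : (0 < q ^+ 2)%R by rewrite exprn_even_gt0.
have T : (0 <= t ^+ 2)%R by rewrite exprn_even_ge0.
have [tq|tq] := leP 0%R (t * q)%R; first by split; nra.
have {}tq : (t * q < - q ^+ 2)%R by rewrite ltNge; apply/negP => h; apply: H; rewrite tq h.
have : (0 < (t + q) * t)%R.
  rewrite -(pmulr_rgt0 _ Q).
  have -> : (q ^+ 2 * ((t + q) * t) = (- (t * q) - q ^+ 2) * - (t * q))%R by ring.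
  by apply: mulr_gt0; lra.
have : (0 <= (t + q) ^+ 2)%R by rewrite exprn_even_ge0.
by split; nra.
Qed.

Lemma position_parabolics l x : position x != slot (letter_inv l) ->
  position (letter_val parabolics l * x) = slot l.
Proof.
case: l => i b npos.
pose m := Posz i.*2.+1; pose q := m10 x; pose t := (m00 x - m * q)%R.
have tq0 : (t != 0)%R || (q != 0)%R.
  rewrite -negb_and; apply/negP => /andP[/eqP t0 /eqP q0].
  have /eqP := sl2z_det x; rewrite -/q q0.
  have -> : m00 x = 0%R by move: t0; rewrite /t q0; lra.
  by rewrite !(mul0r, mulr0).
have em : (m = Posz i.*2 + 1)%R by rewrite /m -addn1.
case: b npos => npos; rewrite /letter_val /= /slot.
- have [|t1 t2] := parabolic_attract tq0.
    move=> [q0 /andP[h1 h2]]; case/eqP: npos; rewrite /slot /= addn1; apply/position_floor.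
    split=> //; rewrite -/q; move: h1 h2; rewrite /t /m; set p := m00 x.
    move=> h1 h2; apply/andP; split; nra.
  rewrite /= addn0; apply/position_floor.
  have eq2 : m10 (parabolics i * x)%g = (q - 2 * t)%R by rewrite /= -/m -/q /t; ring.
  have ep2 : m00 (parabolics i * x)%g = (t + m * m10 (parabolics i * x)%g)%R.
    by rewrite eq2 /= -/m -/q /t; ring.
  rewrite ep2 eq2; move: t1 t2; move: (t) (q) => t' q' t1 t2; split.
    by apply: contraTneq t1 => ->; rewrite mulr0 ltxx.
  by rewrite em; apply/andP; split; nra.
- have [|t1 t2] := parabolic_attractV tq0.
    move=> [q0 /andP[h1 h2]]; case/eqP: npos; rewrite /slot /= addn0; apply/position_floor.
    split=> //; rewrite -/q; move: h1 h2; rewrite /t em; set p := m00 x.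
    move=> h1 h2; apply/andP; split; nra.
  rewrite /= addn1; apply/position_floor.
  have eq2 : m10 ((parabolics i)^-1 * x)%g = (q + 2 * t)%R by rewrite /= -/m -/q /t; ring.
  have ep2 : m00 ((parabolics i)^-1 * x)%g = (t + m * m10 ((parabolics i)^-1 * x)%g)%R.
    by rewrite eq2 /= -/m -/q /t; ring.
  rewrite ep2 eq2; move: t1 t2; move: (t) (q) => t' q' t1 t2; split.
    by apply: contraTneq t2 => ->; rewrite mul0r ltxx.
  by rewrite -/m em; apply/andP; split; nra.
Qed.

(** The parabolic matrix maps the complement of one interval onto the other
    one.  A Hurwitz move needs this sharper form of ping-pong to subdivide the
    image interval in the right order. *)
Lemma position_parabolics_exact i x : position x = slot (i, false) ->
  position (parabolics i * x) != slot (i, true).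
Proof.
rewrite /slot /= addn1 addn0 => /position_floor[].
pose m := Posz i.*2.+1; pose q := m10 x; pose t := (m00 x - m * q)%R.
have em : (m = Posz i.*2 + 1)%R by rewrite /m -addn1.
have -> : m00 x = (t + m * q)%R by rewrite /t; ring.
rewrite -/q -/m => q0 /andP[h1 h2]; apply/eqP => /position_floor[_].
have eq2 : m10 (parabolics i * x)%g = (q - 2 * t)%R by rewrite /= -/m -/q /t; ring.
have ep2 : m00 (parabolics i * x)%g = (t + m * m10 (parabolics i * x)%g)%R.
  by rewrite eq2 /= -/m -/q /t; ring.
rewrite ep2 eq2 em => /andP[h3 h4].
have Q : (0 < q ^+ 2)%R by rewrite exprn_even_gt0.
have a1 : (0 <= t * q)%R by nra.
have a2 : (0 < q * (q - t))%R by nra.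
have a3 : (t * (q - 2 * t) < 0)%R by nra.
have a4 : (0 <= (q - 2 * t) * (q - t))%R by nra.
have a5 : (0 <= q * (q - 2 * t))%R.
  have e : (q * (q - 2 * t) * (q - t) ^+ 2 = (q * (q - t)) * ((q - 2 * t) * (q - t)))%R by ring.
  have qt : (0 < (q - t) ^+ 2)%R.
    by rewrite exprn_even_gt0 //=; apply: contraTneq a2 => ->; rewrite mulr0 ltxx.
  by rewrite -(pmulr_lge0 _ qt) e; apply: mulr_ge0 => //; apply: ltW.
have : (q ^+ 2 * (t * (q - 2 * t)) = (t * q) * (q * (q - 2 * t)))%R by ring.
have := mulr_ge0 a1 a5; have : (q ^+ 2 * (t * (q - 2 * t)) < 0)%R by rewrite pmulr_rlt0.
by lra.
Qed.

Lemma ping_pong_parabolics : ping_pong parabolics position.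
Proof.
split=> [//|x /position0 x0 y z|x y|l x]; first last.
- exact: position_parabolics.
- exact: position_before.
have /eqP := sl2z_det x; rewrite x0 mulr0 subr0 => e.
have P : (0 < m00 x ^+ 2)%R.
  by rewrite exprn_even_gt0 //=; apply: contra_eqT e => /negPn/eqP ->; rewrite mul0r.
rewrite /circ -[RHS](pmulr_rgt0 _ P); congr (0 < _)%R.
by rewrite /coldet x0 /=; ring.
Qed.

(** * The Hurwitz action of braids on tuples *)

(** A tuple is a sequence of group elements, of which a braid on n strands only
    changes the first n. *)
Definition hurwitz_move (G : groupType) (i : nat) (b : bool) (h : nat -> G) : nat -> G :=
  fun j =>
    if j == i then if b then h i * h i.+1 * (h i)^-1 else h i.+1
    else if j == i.+1 then if b then h i else (h i.+1)^-1 * h i * h i.+1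
    else h j.

(** The tuple labels the strands, and the word is read from the top to the
    bottom: entry k of the result is the label of the strand that ends in
    position k at the bottom. *)
Definition hurwitz (G : groupType) n (h : nat -> G) (u : braid_word n) : nat -> G :=
  foldl (fun h' (l : 'I_n.-1 * bool) => hurwitz_move l.1 l.2 h') h u.

(** The effect on labels of replacing two parallel strands k and k + 1 by a
    single one. *)
Definition fuse (G : groupType) (k : nat) (h : nat -> G) : nat -> G :=
  fun j => if (j < k)%N then h j else if j == k then h k * h k.+1 else h j.+1.

Lemma hurwitz_cat (G : groupType) n (h : nat -> G) (u v : braid_word n) :
  hurwitz h (u ++ v) = hurwitz (hurwitz h u) v.
Proof. exact: foldl_cat. Qed.

Ltac index_cases :=
  repeat match goal with
  | |- context [if ?c then _ else _] =>
    lazymatch c with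
    | context [if _ then _ else _] => fail
    | (?x == ?y) => case: (eqVneq x y) => ?; try lia; try subst; rewrite /=
    | _ => case: (boolP c) => ? /=; try lia
    end
  end; try lia.

Lemma hurwitz_cons (G : groupType) n (h : nat -> G) l (u : braid_word n) :
  hurwitz h (l :: u) = hurwitz (hurwitz_move l.1 l.2 h) u.
Proof. by []. Qed.

Lemma hurwitz_moveK (G : groupType) i b (h : nat -> G) :
  hurwitz_move i (~~ b) (hurwitz_move i b h) = h.
Proof.
apply: funext => j; rewrite /hurwitz_move; case: b => /=; index_cases.
all: by rewrite ?mulgA ?mulgVK ?mulVg ?mulgV ?mul1g ?mulgK.
Qed.

Lemma hurwitz_eq (G : groupType) n (u v : braid_word n) (h : nat -> G) :
  braid_word_eq u v -> hurwitz h u = hurwitz h v.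
Proof.
move=> uv; elim: uv h =>
  {u v} [//|u v _ IH h|u v w _ IHu _ IHv h|u u' v v' _ IHu _ IHv h|i b h|i j ij h|i j ij h].
- by rewrite IH.
- by rewrite IHu.
- by rewrite !hurwitz_cat IHu IHv.
- exact: hurwitz_moveK.
- apply: funext => k; rewrite /hurwitz /hurwitz_move /=.
  by case: i j ij => i /= _ [j /= _] ij; index_cases.
- apply: funext => k; rewrite /hurwitz /hurwitz_move /= -ij.
  case: i j ij => i /= _ [j /= _] ij; subst j; index_cases.
  all: by rewrite ?invgM ?invgK ?mulgA ?mulgVK.
Qed.

(** Two parallel strands pass a crossing just as a single strand does whose
    label is the product of theirs. *)
Lemma fuse_hurwitz_move (G : groupType) (i k : nat) b (h : nat -> G) :
  fuse k (if (k == i) || (k == i.+1)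
           then hurwitz_move (bump k i) b (hurwitz_move k b h)
           else hurwitz_move (bump k i) b h) =
  hurwitz_move i b (fuse (swapn i k) h).
Proof.
apply: funext => j; have [ki|ik] := leqP k i.
- have -> : bump k i = i.+1 by rewrite /bump ki.
  by rewrite /swapn /hurwitz_move /fuse; index_cases; rewrite ?invgM ?mulgA ?mulgVK.
- have -> : bump k i = i by rewrite /bump leqNgt ik.
  by rewrite /swapn /hurwitz_move /fuse; index_cases; rewrite ?invgM ?mulgA ?mulgVK ?mulgK.
Qed.

Lemma fuse_hurwitz (G : groupType) n (u : braid_word n) (k : 'I_n) (h : nat -> G) :
  fuse k (hurwitz h (bifurcate_word u k)) = hurwitz (fuse (word_perm u k) h) u.
Proof.
elim: u h => [|l u IH] h; first by rewrite /= word_perm_nil perm1.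
rewrite [bifurcate_word _ _]/= hurwitz_cat IH word_perm_cons permM.
rewrite hurwitz_cons letter_permE -fuse_hurwitz_move.
congr (hurwitz (fuse _ _) u).
by rewrite /bifurcate_letter -!val_eqE /=; case: ifP.
Qed.

(** * Order-preserving substitutions *)

(** Functions of a tuple given by one word, uniformly in the tuple; an order
    between two of them can be transported from one tuple to another. *)
Definition word_map (G : groupType) (F : (nat -> G) -> G) : Prop :=
  exists u, forall h, F h = eval h u.

Lemma word_map1 (G : groupType) : word_map (fun _ : nat -> G => 1).
Proof. by exists [::] => h; rewrite eval_nil. Qed.

Lemma word_map_proj (G : groupType) i : word_map (fun h : nat -> G => h i).
Proof. by exists [:: (i, true)] => h; rewrite eval_cons eval_nil mulg1. Qed.

Lemma word_mapM (G : groupType) (F F' : (nat -> G) -> G) :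
  word_map F -> word_map F' -> word_map (fun h => F h * F' h).
Proof. by move=> [u Fu] [v Fv]; exists (u ++ v) => h; rewrite eval_cat Fu Fv. Qed.

Lemma word_mapV (G : groupType) (F : (nat -> G) -> G) :
  word_map F -> word_map (fun h => (F h)^-1).
Proof.
move=> [u Fu]; exists (rev (map letter_inv u)) => h; rewrite Fu.
elim: u {F Fu} => [|l u IH]; first by rewrite eval_nil invg1.
by rewrite /= rev_cons -cats1 eval_cat -IH !eval_cons eval_nil mulg1 letter_valV invgM.
Qed.

Lemma word_map_comp (G : groupType) (F : (nat -> G) -> G) (P : (nat -> G) -> nat -> G) :
  (forall i, word_map (fun h => P h i)) -> word_map F -> word_map (fun h => F (P h)).
Proof.
move=> wP [u Fu]; have : word_map (fun h => eval (P h) u).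
  elim: u {F Fu} => [|[i b] u IH].
    by have [v e] := word_map1 G; exists v => h; rewrite eval_nil -e.
  have /word_mapM/(_ IH)[v e] : word_map (fun h => letter_val (P h) (i, b)).
    by case: b; [exact: wP | exact/word_mapV/wP].
  by exists v => h; rewrite eval_cons -e.
by case=> v e; exists v => h; rewrite Fu e.
Qed.

Lemma word_map_hurwitz_move (G : groupType) i b j :
  word_map (fun h : nat -> G => hurwitz_move i b h j).
Proof.
rewrite /hurwitz_move; case: eqP => _; last case: eqP => _; case: b.
all: by repeat first [exact: word_map_proj | apply: word_mapM | apply: word_mapV].
Qed.

Lemma word_map_hurwitz (G : groupType) n (u : braid_word n) j :
  word_map (fun h : nat -> G => hurwitz h u j).
Proof.
elim: u j => [|l u IH] j; first exact: word_map_proj.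
apply: (@word_map_comp _ (fun h => hurwitz h u j) (hurwitz_move l.1 l.2)) => // i.
exact: word_map_hurwitz_move.
Qed.

Lemma word_map_fuse (G : groupType) k j : word_map (fun h : nat -> G => fuse k h j).
Proof.
rewrite /fuse; case: (j < k)%N; last case: (j == k).
all: by repeat first [exact: word_map_proj | apply: word_mapM].
Qed.

(** The substitution of h for the parabolic tuple preserves the order of
    words. *)
Definition ordered (h : nat -> sl2z) : Prop := forall F F', word_map F -> word_map F' ->
  before (F h) (F' h) = before (F parabolics) (F' parabolics).

Lemma ping_pong_ordered h pos : ping_pong h pos -> ordered h.
Proof.
move=> pph F F' [u Fu] [v Fv]; rewrite !Fu !Fv.
exact: ping_pong_before pph ping_pong_parabolics.
Qed.

Lemma ordered_comp P h : (forall i, word_map (fun h => P h i)) ->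
  ordered (P parabolics) -> ordered h -> ordered (P h).
Proof.
move=> wP oP oh F F' wF wF'; rewrite -(oP F F') //.
by apply: (oh (F \o P) (F' \o P)); apply: word_map_comp.
Qed.

(** Intervals for the tuple after a Hurwitz move, where a = x_i and b = x_(i+1)
    become c = a b a^-1 and a.  Write I_l for the interval of the letter l in
    the old arrangement I_a, I_A, I_b, I_B, with A and B the inverses of a and
    b.  The new intervals of c and its inverse are a I_b and a I_B, which lie
    inside I_a; the new interval of a is what remains of I_a, and the new
    interval of A is the union of I_A, I_b and I_B. *)
Definition slide_pos (h : nat -> sl2z) (pos : sl2z -> nat) (i : nat) (x : sl2z) : nat :=
  let s := slot (i, true) in let t := pos ((h i)^-1 * x) in
  if pos x == s then if t == s.+2 then s else if t == s.+3 then s.+1 else s.+2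
  else if (s < pos x <= s.+3)%N then s.+3 else pos x.

Lemma slide_pos_spec h pos i x :
  [\/ [/\ pos x = slot (i, true), pos ((h i)^-1 * x) = (slot (i, true)).+2 &
          slide_pos h pos i x = slot (i, true)],
      [/\ pos x = slot (i, true), pos ((h i)^-1 * x) = (slot (i, true)).+3 &
          slide_pos h pos i x = (slot (i, true)).+1],
      [/\ pos x = slot (i, true), pos ((h i)^-1 * x) != (slot (i, true)).+2,
          pos ((h i)^-1 * x) != (slot (i, true)).+3 &
          slide_pos h pos i x = (slot (i, true)).+2] |
      pos x <> slot (i, true) /\
        slide_pos h pos i x =
        if (slot (i, true) < pos x <= (slot (i, true)).+3)%N then (slot (i, true)).+3 else pos x].
Proof.
rewrite /slide_pos; move: (slot (i, true)) (pos ((h i)^-1 * x)) => s t.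
have [xs|xs] := eqVneq (pos x) s; last first.
  by apply: Or44; split=> //; apply/eqP.
have [ts|ts] := eqVneq t s.+2; first exact: Or41.
by have [ts'|ts'] := eqVneq t s.+3; [exact: Or42 | exact: Or43].
Qed.

(** Since a maps the complement of I_A onto I_a and preserves the circular
    order, the image under a of the cyclic arrangement I_b, I_B, and the rest
    of that complement appears in this order inside I_a. *)
Lemma ping_pong_hurwitz_move h pos i : ping_pong h pos ->
    (forall x, pos x = slot (i, false) -> pos (h i * x) != slot (i, true)) ->
  ping_pong (hurwitz_move i true h) (slide_pos h pos i).
Proof.
move=> pph exact_i; have [p1 p0 plt pp] := pph.
have eA : slot (i, false) = (slot (i, true)).+1 by rewrite /slot /=; lia.
have eb : slot (i.+1, true) = (slot (i, true)).+2 by rewrite /slot /=; lia.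
have eB : slot (i.+1, false) = (slot (i, true)).+3 by rewrite /slot /=; lia.
have := pp (i, true); have := pp (i, false).
have := pp (i.+1, true); have := pp (i.+1, false).
rewrite /letter_val /letter_inv /= eb eB eA => ppB ppb ppA ppa.
rewrite eA in exact_i.
have s_gt0 : (0 < slot (i, true))%N by [].
have spec := slide_pos_spec h pos i.
have slot_s l : l.1 != i -> l.1 != i.+1 ->
    (slot l < slot (i, true))%N || ((slot (i, true)).+3 < slot l)%N.
  by rewrite /slot; case: l => j [] /=; lia.
move es : (slot (i, true)) eA eb eB exact_i ppa ppA ppb ppB s_gt0 spec slot_s =>
  s eA eb eB exact_i ppa ppA ppb ppB s_gt0 spec slot_s.
split.
- by case: (spec 1); rewrite p1; [case; lia.. |]; case=> _ ->; case_lia.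
- move=> x px; apply: p0; move: px.
  by case: (spec x); [case; lia.. |]; case=> _ ->; case_lia.
- move=> x y.
  have both : pos x = s -> pos y = s -> ccw s.+1 (pos ((h i)^-1 * x)) (pos ((h i)^-1 * y)) ->
      before x y.
    move=> _ _ uv; rewrite /before -(circM (h i)^-1) mulg1.
    apply: (ping_pong_circ pph); suff -> : pos (h i)^-1 = s.+1 by [].
    by rewrite -[(h i)^-1]mulg1 ppA // p1; lia.
  have nA z : pos z = s -> pos ((h i)^-1 * z) != s.+1.
    by move=> pz; apply/eqP => /exact_i; rewrite mulVKg pz eqxx.
  have one : (0 < pos x < pos y)%N -> before x y by exact: plt.
  have two : pos x = s -> pos y = s ->
      before x y \/ ~~ ccw s.+1 (pos ((h i)^-1 * x)) (pos ((h i)^-1 * y)).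
    by move=> px py; case: (boolP (ccw _ _ _)) => [/both H|]; [left; apply: H | right].
  rewrite /ccw in two.
  by case: (spec x) => [[px tx ->]|[px tx ->]|[px tx tx' ->]|[px ->]];
     case: (spec y) => [[py ty ->]|[py ty ->]|[py ty ty' ->]|[py ->]];
     repeat case_if; move=> ?; try (apply: one; lia);
     (case: (two px py) => // ?; have := nA _ px; have := nA _ py; lia).
- case=> j b x; rewrite /letter_val /letter_inv /= /hurwitz_move.
  have := spec x; set t := pos ((h i)^-1 * x) => spec_x.
  have ta : pos x <> s -> t = s.+1 by move=> /eqP; exact: ppA.
  have [ej|ji] := eqVneq j i; last have [ej|jSi] := eqVneq j i.+1.
  + subst j.
    case: b; rewrite ?invgM ?invgK ?mulgA /= ?es ?eA => npx.
      have tb : pos (h i.+1 * ((h i)^-1 * x)) = s.+2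
        by apply: ppb; case: spec_x npx => [[]|[]|[]|[]]; case_lia.
      have tab : pos (h i * (h i.+1 * ((h i)^-1 * x))) = s by apply: ppa; lia.
      by rewrite -!mulgA; case: (spec (h i * (h i.+1 * ((h i)^-1 * x)))); rewrite ?mulKg;
        case; case_lia.
    have tb : pos ((h i.+1)^-1 * ((h i)^-1 * x)) = s.+3
      by apply: ppB; case: spec_x npx => [[]|[]|[]|[]]; case_lia.
    have tab : pos (h i * ((h i.+1)^-1 * ((h i)^-1 * x))) = s by apply: ppa; lia.
    by rewrite -!mulgA; case: (spec (h i * ((h i.+1)^-1 * ((h i)^-1 * x)))); rewrite ?mulKg;
        case; case_lia.
  + subst j; case: b; rewrite /= ?eb ?eB => npx.
      have tab : pos (h i * x) = s by apply: ppa; case: spec_x npx => [[]|[]|[]|[]]; case_lia.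
      case: (spec (h i * x)); rewrite ?mulKg; case;
        case: spec_x npx => [[]|[]|[]|[]]; case_lia; try done.
    case: (spec ((h i)^-1 * x)); rewrite -/t; case;
      case: spec_x ta npx => [[]|[]|[]|[]]; case_lia; try done.
  + have sl : (slot (j, b) < s)%N || (s.+3 < slot (j, b))%N by exact: (slot_s (j, b)).
    have sl' : (slot (j, ~~ b) < s)%N || (s.+3 < slot (j, ~~ b))%N by exact: (slot_s (j, ~~ b)).
    move=> npx; have tx : pos (letter_val h (j, b) * x) = slot (j, b).
      by apply: (pp (j, b)); rewrite /letter_inv /=; case: spec_x npx => [[]|[]|[]|[]]; case_lia.
    by case: (spec (letter_val h (j, b) * x)); rewrite tx; case; case_lia.
Qed.

(** For the product of a = x_k and b = x_(k+1), the intervals of a, its inverse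
    and b merge into one, and the interval of the inverse of b becomes that of
    the inverse of the product. *)
Definition fuse_pos (pos : sl2z -> nat) (k : nat) (x : sl2z) : nat :=
  let s := slot (k, true) in
  if (pos x <= s)%N then pos x else if (pos x <= s.+2)%N then s else (pos x - 2)%N.

Lemma ping_pong_fuse h pos k : ping_pong h pos -> ping_pong (fuse k h) (fuse_pos pos k).
Proof.
move=> pph; have [p1 p0 plt pp] := pph.
have eA : slot (k, false) = (slot (k, true)).+1 by rewrite /slot /=; lia.
have eb : slot (k.+1, true) = (slot (k, true)).+2 by rewrite /slot /=; lia.
have eB : slot (k.+1, false) = (slot (k, true)).+3 by rewrite /slot /=; lia.
have := pp (k, true); have := pp (k, false).
have := pp (k.+1, true); have := pp (k.+1, false).
rewrite /letter_val /letter_inv /= eb eB eA => ppB ppb ppA ppa.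
have slot_lt j b : (j < k)%N -> (slot (j, b) < slot (k, true))%N.
  by rewrite /slot; case: b => /=; lia.
have slot_gt j b : (k < j)%N ->
    ((slot (k, true)).+1 < slot (j, b))%N /\ slot (j.+1, b) = (slot (j, b)).+2.
  by rewrite /slot; case: b => /=; lia.
have s_gt0 : (0 < slot (k, true))%N by [].
split.
- by rewrite /fuse_pos p1.
- by move=> x px; apply: p0; move: px; rewrite /fuse_pos; case_lia.
- by move=> x y xy; apply: plt; move: xy; rewrite /fuse_pos; case_lia.
- case=> j b x; rewrite /letter_inv /fuse_pos /letter_val /= /fuse.
  have [jk|jk|ej] := ltngtP j k.
  + have := slot_lt j b jk; have := slot_lt j (~~ b) jk => l1 l2 npx.
    have -> : pos ((if b then h j else (h j)^-1) * x) = slot (j, b).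
      by apply: (pp (j, b)); rewrite /letter_inv /=; move: npx; case_lia.
    by case_lia.
  + have [l1 l2] := slot_gt j b jk; have [l3 l4] := slot_gt j (~~ b) jk => npx.
    have -> : pos ((if b then h j.+1 else (h j.+1)^-1) * x) = slot (j.+1, b).
      by apply: (pp (j.+1, b)); rewrite /letter_inv /=; move: npx; case_lia.
    by case_lia.
  subst j; case: b => /= npx.
    have -> : pos (h k * h k.+1 * x) = slot (k, true).
      rewrite -mulgA; apply: ppa; rewrite ppb; last by move: npx; rewrite eA; case_lia.
      by lia.
    by case_lia.
  have -> : pos ((h k * h k.+1)^-1 * x) = (slot (k, true)).+3.
    rewrite invgM -mulgA; apply: ppB; rewrite ppA; last by move: npx; case_lia.
    by lia.
  by rewrite eA; case_lia.
Qed.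

Lemma ordered_parabolics : ordered parabolics.
Proof. exact: ping_pong_ordered ping_pong_parabolics. Qed.

Lemma ordered_hurwitz_move i b h : ordered h -> ordered (hurwitz_move i b h).
Proof.
apply: ordered_comp => [j|]; first exact: word_map_hurwitz_move.
have true_ordered : ordered (hurwitz_move i true parabolics).
  apply: ping_pong_ordered; apply: ping_pong_hurwitz_move ping_pong_parabolics _ => x.
  exact: position_parabolics_exact.
(* The inverse of an order-preserving substitution preserves the order. *)
case: b => // F F' wF wF'.
have cmp := fun F0 => word_map_comp (fun j => word_map_hurwitz_move _ i false j) F0.
by rewrite -(true_ordered _ _ (cmp _ _ wF) (cmp _ _ wF')) /= !(hurwitz_moveK i true).
Qed.

Lemma ordered_hurwitz n (u : braid_word n) h : ordered h -> ordered (hurwitz h u).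
Proof. by elim: u h => // l u IH h oh; apply/IH/ordered_hurwitz_move. Qed.

Lemma ordered_fuse k h : ordered h -> ordered (fuse k h).
Proof.
apply: ordered_comp => [j|]; first exact: word_map_fuse.
exact: ping_pong_ordered (ping_pong_fuse k ping_pong_parabolics).
Qed.

(** * Translation by the boundary element *)
Definition zpow (G : groupType) (x : G) (k : int) : G :=
  match k with Posz n => x ^+ n | Negz n => x ^- n.+1 end.

Lemma zpowS (G : groupType) (x : G) k : zpow x (k + 1)%R = x * zpow x k.
Proof.
case: k => [n|[|n]].
- by rewrite -PoszD addn1 /= expgS.
- by rewrite /= expg1 mulgV.
- have -> : (Negz n.+1 + 1)%R = Negz n by lia.
  by rewrite /= (expgSr x n.+1) invgM mulVKg.
Qed.

Lemma zpow_pred (G : groupType) (x : G) k : zpow x (k - 1)%R = x^-1 * zpow x k.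
Proof. by apply: (mulgI x); rewrite -zpowS subrK mulVKg. Qed.

Lemma zpowD (G : groupType) (x : G) k l : zpow x (k + l)%R = zpow x k * zpow x l.
Proof.
elim/int_rect: k => [|m IH|m IH]; first by rewrite add0r mul1g.
  by rewrite -addn1 PoszD addrAC !zpowS IH mulgA.
by rewrite -addn1 PoszD opprD addrAC !zpow_pred IH mulgA.
Qed.

Lemma zpowN1 (G : groupType) (x : G) : zpow x (-1)%R = x^-1.
Proof. by rewrite -[(-1)%R]add0r zpow_pred mulg1. Qed.

Definition prefix_prod (G : groupType) (p : nat) (h : nat -> G) : G :=
  \prod_(0 <= i < p) h i.

Lemma prefix_prodS (G : groupType) p (h : nat -> G) :
  prefix_prod p.+1 h = prefix_prod p h * h p.
Proof. exact: big_nat_recr. Qed.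

Lemma prefix_prod_eq (G : groupType) p (h h' : nat -> G) :
  (forall i, (i < p)%N -> h i = h' i) -> prefix_prod p h = prefix_prod p h'.
Proof. by move=> e; apply: eq_big_nat => i /e. Qed.

Lemma prefix_prod_fuse (G : groupType) p k (h : nat -> G) :
  prefix_prod (p + (k < p)) h = prefix_prod p (fuse k h).
Proof.
elim: p => [|p IH]; first by rewrite addn0 /prefix_prod !big_nil.
rewrite (prefix_prodS p (fuse k h)) -IH /fuse; have [kp|pk|<-] := ltngtP k p.
- by rewrite ltnS (ltnW kp) !addn1 prefix_prodS.
- by rewrite ltnS leqNgt pk /= !addn0 prefix_prodS.
- by rewrite ltnS leqnn addn0 addn1 !prefix_prodS mulgA.
Qed.

(** A Hurwitz move does not change the product of the two labels involved, so
    only the prefix that ends between them is affected. *)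
Lemma prefix_prod_hurwitz_move (G : groupType) p i b (h : nat -> G) :
  p != i.+1 -> prefix_prod p (hurwitz_move i b h) = prefix_prod p h.
Proof.
move=> pSi; have [ip|ip] := leqP p i.
  by apply: prefix_prod_eq => j jp; rewrite /hurwitz_move; index_cases.
have {pSi}ip : (i.+2 <= p)%N by lia.
elim: p ip => // p IH; rewrite leq_eqVlt => /orP[/eqP[<-]|ip].
  rewrite !prefix_prodS (@prefix_prod_eq _ i _ h) => [|j ji]; last first.
    by rewrite /hurwitz_move; index_cases.
  rewrite -!mulgA; congr (_ * _); rewrite /hurwitz_move !eqxx.
  by index_cases; rewrite ?mulgA ?mulgVK ?mulgV ?mul1g.
rewrite !prefix_prodS IH //; congr (_ * _); rewrite /hurwitz_move.
by index_cases.
Qed.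

Lemma prefix_prod_hurwitz (G : groupType) n (u : braid_word n) (h : nat -> G) :
  prefix_prod n (hurwitz h u) = prefix_prod n h.
Proof.
elim: u h => // l u IH h; rewrite hurwitz_cons IH prefix_prod_hurwitz_move //.
by case: l => -[i /=]; lia.
Qed.

Lemma word_map_prefix_prod (G : groupType) p : word_map (@prefix_prod G p).
Proof.
elim: p => [|p [u e]].
  by have [u e] := word_map1 G; exists u => h; rewrite -e /prefix_prod big_nil.
have [v e'] : word_map (fun h : nat -> G => eval h u * h p).
  by apply: word_mapM; [exists u | exact: word_map_proj].
by exists v => h; rewrite prefix_prodS e e'.
Qed.

Lemma word_map_zpow (G : groupType) (F : (nat -> G) -> G) k :
  word_map F -> word_map (fun h => zpow (F h) k).
Proof.
move=> wF; have wX n : word_map (fun h => F h ^+ n).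
  elim: n => [|n [u e]]; first exact: word_map1.
  have [v e'] : word_map (fun h => F h * eval h u) by apply: word_mapM => //; exists u.
  by exists v => h; rewrite expgS e e'.
by case: k => n; [exact: wX | apply: word_mapV; exact: wX].
Qed.

Lemma word_map_prefix_zpow (G : groupType) n p k :
  word_map (fun h : nat -> G => zpow (prefix_prod n h) k * prefix_prod p h).
Proof.
apply: word_mapM; last exact: word_map_prefix_prod.
by apply: word_map_zpow; apply: word_map_prefix_prod.
Qed.

Lemma word_map_prefix_hurwitz (G : groupType) n (u : braid_word n) p :
  word_map (fun h : nat -> G => prefix_prod p (hurwitz h u)).
Proof.
apply: (@word_map_comp _ (@prefix_prod _ p)); last exact: word_map_prefix_prod.
by move=> i; apply: word_map_hurwitz.
Qed.

(** Left multiplication by d preserves only the circular order, and disturbs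
    the cut at infinity.  The points whose translates all lie above d, the
    image of infinity, form a set on which it is strictly increasing. *)
Definition moderate (d x : sl2z) : Prop := forall k, before d (zpow d k * x).

Lemma moderate_zpow d x k : moderate d x -> moderate d (zpow d k * x).
Proof. by move=> mx l; rewrite mulgA -zpowD. Qed.

Lemma before_mulV d x : before d (d * x) = before x d^-1.
Proof. by rewrite /before -(circM d^-1) mulg1 mulKg mulVg circ_rot. Qed.

Lemma before_mull d x y : before x y -> before y d^-1 -> before (d * x) (d * y).
Proof.
move=> xy yd; rewrite /before -(circM d^-1) mulg1 !mulKg circ_rot.
exact: circ_before.
Qed.

Lemma before_mulVl d x y : before d x -> before x y -> before (d^-1 * x) (d^-1 * y).
Proof.
move=> dx xy; rewrite /before -(circM d) mulg1 !mulVKg.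
exact: circ_before.
Qed.

Lemma moderate_before d x : moderate d x -> before x d^-1.
Proof. by move=> mx; rewrite -before_mulV; exact: (mx 1%R). Qed.

Lemma moderate_fin d x : moderate d x -> m10 x != 0%R.
Proof. by move=> /moderate_before/before_fin[]. Qed.

Lemma before_zpow d x y k : moderate d x -> moderate d y ->
  before x y -> before (zpow d k * x) (zpow d k * y).
Proof.
move=> mx my xy; elim/int_rect: k => [|m IH|m IH]; first by rewrite !mul1g.
  rewrite -addn1 PoszD !zpowS -!mulgA; apply: before_mull => //.
  exact/moderate_before/moderate_zpow.
by rewrite -addn1 PoszD opprD !zpow_pred -!mulgA; apply: before_mulVl.
Qed.

(** It suffices to look at one step: the translates decrease along positive
    powers of d but stay above d, and they increase along negative powers of d
    but stay below the inverse of d. *)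
Lemma moderate_base d x : before d x -> before (d * x) x -> before x d^-1 -> moderate d x.
Proof.
move=> dx dxx xd k.
suff [] : [/\ before d (zpow d k * x), before (d * (zpow d k * x)) (zpow d k * x)
             & before (zpow d k * x) d^-1] by [].
elim/int_rect: k => [|m [IH1 IH2 IH3]|m [IH1 IH2 IH3]]; first by rewrite mul1g.
  rewrite -addn1 PoszD zpowS -mulgA; split.
  - by rewrite before_mulV.
  - exact: before_mull.
  - exact: before_trans IH2 IH3.
rewrite -addn1 PoszD opprD zpow_pred -mulgA mulVKg; set y := zpow d _ * x in IH1 IH2 IH3 *.
have yy : before y (d^-1 * y).
  by rewrite -{1}(mulKg d y); apply: before_mulVl => //; rewrite before_mulV.
split=> //; first exact: before_trans yy.
by rewrite -before_mulV mulVKg.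
Qed.

Lemma position_parabolic i x : position x != i.*2.+3 ->
  position (parabolics i * x) = i.*2.+2.
Proof. by have := @position_parabolics (i, true) x; rewrite /letter_val /slot /= addn0 addn1. Qed.

Lemma position_parabolicV i x : position x != i.*2.+2 ->
  position ((parabolics i)^-1 * x) = i.*2.+3.
Proof. by have := @position_parabolics (i, false) x; rewrite /letter_val /slot /= addn0 addn1. Qed.

Definition segment (p r : nat) : sl2z := \prod_(p <= i < r) parabolics i.

Lemma position_segment p r x : (p < r)%N -> position x != r.*2.+1 ->
  position (segment p r * x) = p.*2.+2.
Proof.
elim: r x => // r IH x; rewrite ltnS => pr xr.
rewrite /segment big_nat_recr //= -mulgA -/(segment p r).
have xr' := position_parabolic xr; move: pr; rewrite leq_eqVlt => /orP[/eqP ->|pr].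
  by rewrite /segment big_geq // mul1g.
by apply: IH => //; rewrite xr'; lia.
Qed.

Lemma position_segmentV p r x : (p < r)%N -> position x != p.*2.+2 ->
  position ((segment p r)^-1 * x) = r.*2.+1.
Proof.
elim: r x => // r IH x; rewrite ltnS => pr xp.
rewrite /segment big_nat_recr //= invgM -mulgA -/(segment p r).
rewrite position_parabolicV //; move: pr; rewrite leq_eqVlt => /orP[/eqP <-|pr].
  by rewrite /segment big_geq // invg1 mul1g.
by rewrite IH //; lia.
Qed.

Lemma prefix_segment p r : (p <= r)%N ->
  (prefix_prod p parabolics)^-1 * prefix_prod r parabolics = segment p r.
Proof. by move=> pr; rewrite /prefix_prod (big_cat_nat (leq0n p) pr) mulKg. Qed.

Lemma prefix_prod_segment p : prefix_prod p parabolics = segment 0 p.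
Proof. by []. Qed.

(** After division by the prefix of length p, the three points start with the
    inverse of x_(p-1), with x_p, and at infinity. *)
Lemma before_prefix n p x : (0 < p < n)%N -> position x != n.*2.+1 ->
  before (prefix_prod n parabolics * x) (prefix_prod p parabolics).
Proof.
case/andP=> p0 pn xn.
rewrite /before -(circM (prefix_prod p parabolics)^-1) mulg1 mulVg mulgA.
rewrite prefix_segment ?(ltnW pn) //.
apply: (ping_pong_circ ping_pong_parabolics).
rewrite position_segment // prefix_prod_segment -[_^-1]mulg1 position_segmentV //.
by rewrite /ccw /=; lia.
Qed.

Lemma position_prefix p : (0 < p)%N -> position (prefix_prod p parabolics) = 2.
Proof. by move=> p0; rewrite prefix_prod_segment -[segment _ _]mulg1 position_segment. Qed.

Lemma before_prefixV n p x : (0 < p < n)%N -> (0 < position x <= n.*2)%N ->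
  before x ((prefix_prod n parabolics)^-1 * prefix_prod p parabolics).
Proof.
case/andP=> p0 pn xn; have [_ _ H _] := ping_pong_parabolics; apply: H.
rewrite -[_ * _]invgK invgM invgK prefix_segment ?(ltnW pn) //.
by rewrite -[_^-1]mulg1 position_segmentV //; lia.
Qed.

Lemma moderate_prefix n p : (0 < p < n)%N ->
  moderate (prefix_prod n parabolics) (prefix_prod p parabolics).
Proof.
move=> pn; have p0 : (0 < p)%N by case/andP: pn.
apply: moderate_base.
- by rewrite -{1}[prefix_prod n _]mulg1; apply: before_prefix.
- by apply: before_prefix; rewrite // position_prefix //; lia.
- have [_ _ H _] := ping_pong_parabolics; apply: H.
  rewrite position_prefix // prefix_prod_segment -[_^-1]mulg1 position_segmentV //; lia.
Qed.

(** Braids preserve the order and fix d, so this follows from the case of the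
    trivial braid. *)
Lemma moderate_hurwitz n p (u : braid_word n) : (0 < p < n)%N ->
  moderate (prefix_prod n parabolics) (prefix_prod p (hurwitz parabolics u)).
Proof.
move=> pn k; have := ordered_hurwitz u ordered_parabolics.
move=> /(_ (prefix_prod n) (fun h => zpow (prefix_prod n h) k * prefix_prod p h)).
rewrite prefix_prod_hurwitz => ->; first exact: moderate_prefix.
  exact: word_map_prefix_prod.
exact: word_map_prefix_zpow.
Qed.

(** A lower bound k for the number of steps of d by which a braid displaces the
    reference point, which is a prefix of length p at the top and of length q
    at the bottom.  As d moves points down, a larger k is a stronger claim. *)
Definition shift_below n (u : braid_word n) (p q : nat) (k : int) : bool :=
  before (prefix_prod q (hurwitz parabolics u))
         (zpow (prefix_prod n parabolics) k * prefix_prod p parabolics).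

Lemma shift_below_eq n (u v : braid_word n) p q k :
  braid_word_eq u v -> shift_below u p q k = shift_below v p q k.
Proof. by move=> uv; rewrite /shift_below (hurwitz_eq _ uv). Qed.

Lemma before_hurwitz n (u v : braid_word n) p q k :
  before (prefix_prod q (hurwitz (hurwitz parabolics u) v))
    (zpow (prefix_prod n parabolics) k * prefix_prod p (hurwitz parabolics u)) =
  shift_below v p q k.
Proof.
have := ordered_hurwitz u ordered_parabolics.
move=> /(_ (fun h => prefix_prod q (hurwitz h v))
  (fun h => zpow (prefix_prod n h) k * prefix_prod p h)).
rewrite prefix_prod_hurwitz; apply.
  exact: word_map_prefix_hurwitz.
exact: word_map_prefix_zpow.
Qed.

(** The inequality for v is transported by u, and the one for u is translated
    by d ^ l. *)
Lemma shift_below_cat n (u v : braid_word n) p q r k l :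
  (0 < p < n)%N -> (0 < q < n)%N ->
  shift_below u p q k -> shift_below v q r l -> shift_below (u ++ v) p r (k + l)%R.
Proof.
move=> pn qn uk; rewrite -(before_hurwitz u) => vl.
rewrite /shift_below hurwitz_cat addrC zpowD -mulgA; apply: before_trans vl _.
apply: before_zpow uk; first exact: moderate_hurwitz.
exact/moderate_zpow/moderate_prefix.
Qed.

Lemma shift_below_nil n p q : (0 < p < n)%N -> (0 < q < n)%N ->
  @shift_below n [::] p q (-1)%R.
Proof.
move=> pn qn; rewrite /shift_below zpowN1; apply: before_prefixV => //.
by rewrite position_prefix; lia.
Qed.

Lemma shift_below_letter n l p : (0 < p < n)%N -> @shift_below n [:: l] p p (-1)%R.
Proof.
move=> pn; rewrite /shift_below zpowN1; apply: before_prefixV => //.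
rewrite /hurwitz /=; case: l => [[i /= ni] b].
have [->|pi] := eqVneq p i.+1; last first.
  by rewrite prefix_prod_hurwitz_move // position_prefix; lia.
rewrite prefix_prodS (@prefix_prod_eq _ i _ parabolics) => [|j ji]; last first.
  by rewrite /hurwitz_move; index_cases.
set y := hurwitz_move _ _ _ _; suff y2 : i.*2.+2 <= position y <= i.*2.+4.
  have [i0|i0] := posnP i; last by rewrite position_segment //; lia.
  by rewrite prefix_prod_segment i0 /segment big_geq // mul1g; lia.
rewrite /y /hurwitz_move eqxx; case: b {y} => /=.
  have e1 : position (parabolics i)^-1 = i.*2.+3.
    by rewrite -[_^-1]mulg1 position_parabolicV.
  have e2 : position (parabolics i.+1 * (parabolics i)^-1) = i.+1.*2.+2.
    by apply: position_parabolic; rewrite e1; lia.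
  by rewrite -mulgA position_parabolic ?e2; lia.
by rewrite -[parabolics _]mulg1 position_parabolic //; lia.
Qed.

(** Each letter of the word lowers the bound by one, as a single crossing moves
    a reference point up by less than one step. *)
Lemma shift_below_size n (u : braid_word n) p q : (0 < p < n)%N -> (0 < q < n)%N ->
  shift_below u p q (- (Posz (size u)) - 1)%R.
Proof.
move=> pn qn; elim: u => [|l u IH]; first by rewrite oppr0 add0r; apply: shift_below_nil.
have := shift_below_cat pn pn (shift_below_letter l pn) IH.
by congr (shift_below _ _ _ _); rewrite /=; lia.
Qed.

Lemma before_prefix_step n p k : (0 < p < n)%N ->
  before (zpow (prefix_prod n parabolics) (k + 1)%R * prefix_prod p parabolics)
         (zpow (prefix_prod n parabolics) k * prefix_prod p parabolics).
Proof.
move=> pn; have mp := moderate_prefix pn.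
rewrite zpowD -mulgA; apply: before_zpow => //; first exact: moderate_zpow.
by apply: before_prefix; rewrite // position_prefix; lia.
Qed.

Lemma shift_below_nil_neg n p k : (0 < p < n)%N -> @shift_below n [::] p p k -> (k < 0)%R.
Proof.
move=> pn; rewrite ltNge; case: k => // m; apply: contraL => _.
elim: m => [|m IH]; first by rewrite /shift_below mul1g; exact: before_irr.
apply: contra IH; rewrite /shift_below -addn1 PoszD => h.
exact: before_trans h (before_prefix_step _ pn).
Qed.

(** If the translate by d ^ k does not lie above the moved reference point, then
    the translate by d ^ (k + 1) lies strictly below it, by cotransitivity; the
    inverse braid turns this into a bound for itself. *)
Lemma shift_below_dual n (u : braid_word n) p q k : (0 < p < n)%N -> (0 < q < n)%N ->
  ~~ shift_below u p q k -> shift_below (word_inv u) q p (- k - 1)%R.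
Proof.
move=> pn qn nu; rewrite -(before_hurwitz u) -hurwitz_cat.
rewrite (hurwitz_eq _ (word_mulV u)).
have mq := moderate_hurwitz u qn; have mp := moderate_prefix pn.
have := before_cotrans (moderate_fin mq) (before_prefix_step k pn).
rewrite -/(shift_below _ _ _ _) (negbTE nu) orbF.
move=> /(before_zpow (- k - 1)%R (moderate_zpow _ mp) mq).
by rewrite mulgA -zpowD addrACA !addNr mul1g.
Qed.

(** The fused tuple of generators is again ordered, so the comparison for the
    bifurcated braid is one for the original braid. *)
Lemma shift_below_bifurcate n (u : braid_word n) (k : 'I_n) p q m :
  shift_below (bifurcate_word u k) (p + (word_perm u k < p)) (q + (k < q)) m =
  shift_below u p q m.
Proof.
rewrite /shift_below !prefix_prod_fuse fuse_hurwitz.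
have -> : prefix_prod n.+1 parabolics = prefix_prod n (fuse (word_perm u k) parabolics).
  by rewrite -prefix_prod_fuse ltn_ord addn1.
have := ordered_fuse (word_perm u k) ordered_parabolics.
move=> /(_ (fun h => prefix_prod q (hurwitz h u))
  (fun h => zpow (prefix_prod n h) m * prefix_prod p h)); apply.
  exact: word_map_prefix_hurwitz.
exact: word_map_prefix_zpow.
Qed.

(** * Displacement on the group bV *)

(** The value at the one-vertex tree is a dummy: representatives on at least two
    leaves are used throughout, for which the reference prefix is neither empty
    nor the full product d. *)
Definition left_leaves (t : btree) : nat := if t is Node l _ then leaves l else 0.

Lemma left_leaves_bounds n (t : tree n) : (1 < n)%N -> (0 < left_leaves t < n)%N.
Proof.
case: t => [[|l r] /= /eqP <-] // _.
by rewrite leaves_gt0 -[X in (X < _)%N]addn0 ltn_add2l leaves_gt0.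
Qed.

Lemma left_leaves_expand n (t : tree n) (k : 'I_n) : (1 < n)%N ->
  left_leaves (tree_expand t k) = (left_leaves t + (k < left_leaves t))%N.
Proof.
case: t => [[|l r] e] n1 /=; first by move: e n1 => /= /eqP <-.
by case: ifP => _ /=; rewrite ?leaves_add_caret ?addn1 ?addn0.
Qed.

Definition triple_shift n (x : triple n) (m : int) : bool :=
  shift_below (word_of (tbraid x)) (left_leaves (tminus x)) (left_leaves (tplus x)) m.

Lemma triple_shift_expand n (x : triple n) k m : (1 < n)%N ->
  triple_shift (expand x k) m = triple_shift x m.
Proof.
move=> n1; rewrite /triple_shift /expand /bifurcate.
rewrite [tbraid _]/= [tminus _]/= [tplus (Triple _ _ _)]/= !left_leaves_expand //.
by rewrite (shift_below_eq _ _ _ (word_of_braid_of _)) shift_below_bifurcate.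
Qed.

Lemma triple_shift_expands n p (x : triple n) (y : triple p) m : (1 < n)%N ->
  expands expand x y -> triple_shift y m = triple_shift x m.
Proof.
move=> n1 xy; elim: xy n1 => {n p x y} // n p x k y _ IH n1.
by rewrite IH ?triple_shift_expand // ltnW.
Qed.

Definition bV_shift (g : bV) (m : int) : Prop :=
  exists n (x : triple n), [/\ (1 < n)%N, g = [bV tminus x, tbraid x, tplus x] & triple_shift x m].

Lemma bV_shiftE n (a c : tree n) (b : braid n) m : (1 < n)%N ->
  bV_shift [bV a, b, c] m <->
  shift_below (word_of b) (left_leaves a) (left_leaves c) m.
Proof.
move=> n1; split=> [[p [[a' b' c'] [p1]]]|]; last by exists n, (Triple a b c).
move=> /Defs.class_eqP[q [z [xz yz]]] H.
rewrite -[shift_below _ _ _ _]/(triple_shift (Triple a b c) m).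
by rewrite -(triple_shift_expands m n1 xz) (triple_shift_expands m p1 yz).
Qed.

(** One expansion of a composable pair suffices, since trees have at least one
    leaf. *)
Lemma bV_composable_wide (x y : bV) : exists n (a c d : tree n) (b g : braid n),
  [/\ (1 < n)%N, x = [bV a, b, c] & y = [bV c, g, d]].
Proof.
have [n [a [c [d [b [g [-> ->]]]]]]] := bV_composable x y.
have n0 : (0 < n)%N by rewrite -(eqP (tree_leaves a)) leaves_gt0.
pose k := Ordinal n0.
exists n.+1, (tree_expand a (rho b (rho g k))), (tree_expand c (rho g k)), (tree_expand d k),
  (bifurcate b (rho g k)), (bifurcate g k).
by split; rewrite // -class_expand.
Qed.

Lemma bV_repr_wide (x : bV) : exists n (a c : tree n) (b : braid n),
  (1 < n)%N /\ x = [bV a, b, c].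
Proof. by have [n [a [c [_ [b [_ [n1 -> _]]]]]]] := bV_composable_wide x x; exists n, a, c, b. Qed.

Lemma bV_shiftM g h k l : bV_shift g k -> bV_shift h l -> bV_shift (g * h) (k + l)%R.
Proof.
have [n [a [c [d [b [b' [n1 -> ->]]]]]]] := bV_composable_wide g h.
rewrite [_ * _]bV_mulE !bV_shiftE // => bk b'l.
rewrite (shift_below_eq _ _ _ (word_of_braid_of _)).
by apply: shift_below_cat bk b'l; apply: left_leaves_bounds.
Qed.

Lemma bV_shift1 k : bV_shift 1 k -> (k < 0)%R.
Proof.
have [n [a [_ [_ [n1 _]]]]] := bV_repr_wide 1.
have -> : 1 = [bV a, 1, a] :> bV by exact: bV_oneE.
rewrite bV_shiftE // (shift_below_eq _ _ _ (word_of_braid_of [::])).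
exact/shift_below_nil_neg/left_leaves_bounds.
Qed.

Lemma bV_shift1N1 : bV_shift 1 (-1)%R.
Proof.
have [n [a [_ [_ [n1 _]]]]] := bV_repr_wide 1.
have -> : 1 = [bV a, 1, a] :> bV by exact: bV_oneE.
rewrite bV_shiftE // (shift_below_eq _ _ _ (word_of_braid_of [::])).
by apply: shift_below_nil; apply: left_leaves_bounds.
Qed.

Lemma bV_shift_dual g k : ~ bV_shift g k -> bV_shift g^-1 (- k - 1)%R.
Proof.
have [n [a [c [b [n1 ->]]]]] := bV_repr_wide g.
rewrite [_^-1]bV_invE !bV_shiftE // => /negP nb.
rewrite (shift_below_eq _ _ _ (word_of_braid_of _)).
by apply: shift_below_dual nb; apply: left_leaves_bounds.
Qed.

Lemma bV_shift_exists g : exists k, bV_shift g k.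
Proof.
have [n [a [c [b [n1 ->]]]]] := bV_repr_wide g.
eexists; apply/bV_shiftE => //.
by apply: shift_below_size; apply: left_leaves_bounds.
Qed.

(** The largest bound for g is almost minus the largest bound for its inverse:
    at the first k that is not a bound for g, the dual statement gives a bound
    for the inverse. *)
Lemma bV_shift_threshold g : exists k, bV_shift g (k - 1)%R /\ bV_shift g^-1 (- k - 1)%R.
Proof.
have [k0 gk0] := bV_shift_exists g; have [l0 gl0] := bV_shift_exists g^-1.
have bound k : bV_shift g k -> (k + l0 < 0)%R.
  by move=> gk; apply: bV_shift1; rewrite -(mulgV g); apply: bV_shiftM.
have ex : exists i : nat, `[< ~ bV_shift g (k0 + Posz i)%R >].
  exists (absz (k0 + l0)%R); apply/asboolP => /bound; lia.
case: (ex_minnP ex) => [[|i]] /asboolP; first by rewrite addr0.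
move=> ni mini; exists (k0 + Posz i.+1)%R; split; last exact: bV_shift_dual.
apply: contrapT => H; have /mini : `[< ~ bV_shift g (k0 + Posz i)%R >].
  by apply/asboolP; congr (~ bV_shift g _): H; lia.
by rewrite ltnn.
Qed.

(** The thresholds of g and h cancel, and each of the four factors contributes
    an error of 1. *)
Lemma bV_shift_comm g h : bV_shift [~ g, h] (-4)%R.
Proof.
have [k [gk gVk]] := bV_shift_threshold g; have [l [hl hVl]] := bV_shift_threshold h.
have := bV_shiftM (bV_shiftM gVk hVl) (bV_shiftM gk hl).
by rewrite commgEl conjgE !mulgA; congr bV_shift; lia.
Qed.

(** The inverse is bounded because a product with its inverse is 1, whose
    displacement bounds are negative: a large bound for a product of few
    commutators would contradict this. *)
Lemma bV_shift_prod_comm (s : seq (bV * bV)) :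
  bV_shift (\prod_(c <- s) [~ c.1, c.2])^-1 (- 4 * Posz (size s) - 1)%R.
Proof.
elim: s => [|c s IH]; first by rewrite big_nil invg1; exact: bV_shift1N1.
rewrite big_cons invgM invgR; have := bV_shiftM IH (bV_shift_comm c.2 c.1).
by congr bV_shift; rewrite /=; lia.
Qed.

Definition caret : tree 2 := @Tree 2 (Node Leaf Leaf) isT.

Fixpoint full_twists (m : nat) : braid_word 2 :=
  if m is m'.+1 then [:: (ord0, true), (ord0, true) & full_twists m'] else [::].

Lemma hurwitz_full_twists (G : groupType) (h : nat -> G) m :
  hurwitz h (full_twists m) 0 =
  prefix_prod 2 h ^+ m * h 0%N * prefix_prod 2 h ^- m.
Proof.
elim: m h => [|m IH] h; first by rewrite mul1g invg1 mulg1.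
rewrite [full_twists _]/= !hurwitz_cons IH !prefix_prod_hurwitz_move //.
rewrite expgSr invgM -!mulgA; congr (_ * _); rewrite !mulgA; congr (_ * _).
by rewrite !prefix_prodS /prefix_prod big_nil mul1g /hurwitz_move /= invgM invgK !mulgA mulgVK.
Qed.

(** The reference point x_0 becomes d ^ m x_0 d ^ (- m).  This lies below
    d ^ (m - 1) x_0, because x_0 d ^ (- m) starts with x_0, while d ^ (- 1) x_0
    starts with the inverse of x_1, whose interval is the last one. *)
Lemma full_twists_shift m : shift_below (full_twists m) 1 1 (Posz m - 1)%R.
Proof.
set d := prefix_prod 2 parabolics; set a := parabolics 0.
have e1 (h : nat -> sl2z) : prefix_prod 1 h = h 0%N by rewrite /prefix_prod big_nat1.
have ma : moderate d a by have := @moderate_prefix 2 1 isT; rewrite e1.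
have mx := moderate_hurwitz (full_twists m) (isT : (0 < 1 < 2)%N).
rewrite /shift_below zpowD zpowN1 !e1 -mulgA -/d.
move: mx; rewrite e1 hurwitz_full_twists -/d -/a -mulgA => mx.
apply: (@before_zpow d _ _ m).
- have := moderate_zpow (- Posz m)%R mx.
  by rewrite (mulgA _ (d ^+ m)) -[d ^+ m]/(zpow d m) -zpowD addNr mul1g.
- by rewrite -zpowN1; apply: moderate_zpow.
have := @before_prefixV 2 1 (a * d ^- m) isT; rewrite e1; apply.
rewrite position_parabolic //.
suff : (position (d ^- m) != 2%N) && (position (d ^- m) != 3%N) by case/andP.
elim: (m) => [|m' IH]; first by rewrite invg1.
rewrite expgSr invgM /d prefix_prod_segment position_segmentV // -prefix_prod_segment.
by case/andP: IH.
Qed.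

Theorem corollary4p4 : ~ uniformly_perfect bV.
Proof.
case=> N perfectN; pose m := (4 * N + 2)%N.
pose g : bV := [bV caret, braid_of (full_twists m), caret].
have gm : bV_shift g (Posz m - 1)%R.
  apply/bV_shiftE => //; rewrite (shift_below_eq _ _ _ (word_of_braid_of _)).
  exact: full_twists_shift.
have [s sN eg] := perfectN g.
have := bV_shiftM gm (bV_shift_prod_comm s); rewrite -eg mulgV => /bV_shift1.
by move: (size _) sN => t; rewrite /m; lia.
Qed.
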